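(* Let $\mathscr{C}$ be a category with finite limits, $\mathscr{P}$ a projective class in $\mathscr{C}$, $\mathscr{B}$ an abelian category, and $F\colon \mathscr{C}\to\mathscr{B}$ a functor (not assumed additive in any sense). Let $\mathbf{L}^{\Delta}_nF\colon \mathscr{C}\to\mathscr{B}$, $n\ge 0$, be the (Tierney–Vogel) simplicial derived functors of $F$ with respect to $\mathscr{P}$, and let $\mathbf{L}^{\Box}_nF\colon \mathscr{C}\to\mathscr{B}$, $n\ge 0$, be the cubical derived functors of $F$ with respect to $\mathscr{P}$. Then there is an isomorphism $$\mathbf{L}^{\Delta}_nF(C)\cong \mathbf{L}^{\Box}_nF(C),\qquad C\in\mathscr{C},\ n\ge 0,$$ which is natural in $F$ and in $C$.
   Context: **Projective class.** Let $\mathscr{C}$ have finite limits and let $\mathscr{P}$ be a class of objects of $\mathscr{C}$. A morphism $f\colon X\to Y$ is a $\mathscr{P}$-epimorphism if $f_*\colon \mathrm{Hom}_{\mathscr{C}}(Q,X)\to \mathrm{Hom}_{\mathscr{C}}(Q,Y)$ is surjective for all $Q\in\mathscr{P}$. $\mathscr{P}$ is a projective class if for every $C\in\mathscr{C}$ there is a $\mathscr{P}$-epimorphism $P\to C$ with $P\in\mathscr{P}$. **Simplicial derived functors.** A presimplicial object $S$ is a family $(S_n)_{n\ge0}$ with morphisms $\partial_i\colon S_n\to S_{n-1}$ ($n\ge1$, $0\le i\le n$) satisfying $\partial_i\partial_j=\partial_{j-1}\partial_i$ for $i<j$. An augmentation over $C$ is a morphism $\partial_0\colon S_0\to C$ with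 $\partial_0\partial_0=\partial_0\partial_1\colon S_1\to C$; put $S_{-1}=C$. The augmented object $S\to C$ is $\mathscr{P}$-exact if for every $Q\in\mathscr{P}$: $\mathrm{Hom}(Q,S_0)\to\mathrm{Hom}(Q,C)$ is surjective, and for each $n\ge0$ and each family $x_0,\dots,x_{n+1}\in\mathrm{Hom}(Q,S_n)$ with $\partial_ix_j=\partial_{j-1}x_i$ for $0\le i<j\le n+1$ there is $x\in\mathrm{Hom}(Q,S_{n+1})$ with $\partial_ix=x_i$ for all $0\le i\le n+1$ (equivalently, $S_0\to C$ and the maps from $S_{n+1}$ to the corresponding simplicial kernels are $\mathscr{P}$-epimorphisms). A $\mathscr{P}$-projective presimplicial resolution of $C$ is a $\mathscr{P}$-exact augmented presimplicial object $S\to C$ with all $S_n\in\mathscr{P}$. For a presimplicial object $S$ in a preadditive category, $K(S)$ is the chain complex $K(S)_n=S_n$, $\partial=\sum_{i=0}^n(-1)^i\partial_i$. Choosing for each $C$ a $\mathscr{P}$-projective presimplicial resolution $S\to C$, define $\mathbf{L}^{\Delta}_nF(C)=H_n(K(F(S)))$. A morphism $C\to C'$ extends to a map of chosen resolutions commuting with the faces and augmentations, unique up to presimplicial homotopy; this makes $\mathbf{L}^{\Delta}_nF$ a well-defined functor, functorial also in $F$. **Cubical derived functors.** A pseudocubical object $X$ is a family $(X_n)_{n\ge0}$ with faces $\partial_i^0,\partial_i^1\colon X_n\to X_{n-1}$ and pseudodegeneracies $s_i\colon X_{n-1}\to X_n$ ($n\ge1$, $1\le i\le n$) satisfying, for $\alpha,\varepsilon\in\{0,1\}$,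 $\partial_i^\alpha\partial_j^\varepsilon=\partial_{j-1}^\varepsilon\partial_i^\alpha$ for $i<j$, and $\partial_i^\alpha s_j=s_{j-1}\partial_i^\alpha$ for $i<j$, $\partial_i^\alpha s_i=\mathrm{id}$, $\partial_i^\alpha s_j=s_j\partial_{i-1}^\alpha$ for $i>j$. An augmentation over $C$ is a morphism $\partial\colon X_0\to C$ with $\partial\partial_1^0=\partial\partial_1^1$. The augmented object $X\to C$ is $\mathscr{P}$-exact if for every $Q\in\mathscr{P}$: (a) $\mathrm{Hom}(Q,X_0)\to\mathrm{Hom}(Q,C)$ is surjective; (b) for $x,y\in\mathrm{Hom}(Q,X_0)$ with $\partial x=\partial y$ there is $z\in\mathrm{Hom}(Q,X_1)$ with $\partial_1^0z=x$, $\partial_1^1z=y$; (c) for $n\ge1$ and any $x_i^\varepsilon\in\mathrm{Hom}(Q,X_n)$ ($1\le i\le n+1$, $\varepsilon\in\{0,1\}$) with $\partial_i^\alpha x_j^\varepsilon=\partial_{j-1}^\varepsilon x_i^\alpha$ for $1\le i<j\le n+1$, $\alpha,\varepsilon\in\{0,1\}$, there is $x\in\mathrm{Hom}(Q,X_{n+1})$ with $\partial_i^\varepsilon x=x_i^\varepsilon$ for all $i,\varepsilon$. A $\mathscr{P}$-projective pseudocubical resolution of $C$ is a $\mathscr{P}$-exact augmented pseudocubical object $X\to C$ with all $X_n\in\mathscr{P}$; these exist for every $C$. For a pseudocubical object $X$ in an abelian category, the normalized chain complex $N(X)$ is $N(X)_0=X_0$, $N(X)_n=\bigcap_{i=1}^n\mathrm{Ker}(\partial_i^1)$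 for $n>0$, with $\partial=\sum_{i=1}^n(-1)^{i+1}\partial_i^0$. Choosing for each $C$ a $\mathscr{P}$-projective pseudocubical resolution $X\to C$, define $\mathbf{L}^{\Box}_nF(C)=H_n(N(F(X)))$. A morphism $C\to C'$ extends to a map of chosen resolutions commuting with faces and augmentations (not necessarily with pseudodegeneracies), unique up to precubical homotopy, and $N$ is homotopy invariant; this makes $\mathbf{L}^{\Box}_nF$ a well-defined functor, functorial also in $F$. *)

(* Defs.v *)
From HB Require Import structures.
From mathcomp Require Import all_boot all_order all_algebra zify.
From mathcomp Require Import boolp.

Set Implicit Arguments.
Unset Strict Implicit.
Unset Printing Implicit Defensive.

Import GRing.Theory.

Declare Scope cat_scope.
Delimit Scope cat_scope with cat.
Local Open Scope cat_scope.

Record category := Category {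
  obj :> Type;
  hom : obj -> obj -> Type;
  idm : forall a, hom a a;
  comp : forall a b c, hom b c -> hom a b -> hom a c;
  comp1m : forall a b (f : hom a b), comp (idm b) f = f;
  compm1 : forall a b (f : hom a b), comp f (idm a) = f;
  compA : forall a b c d (h : hom c d) (g : hom b c) (f : hom a b),
    comp h (comp g f) = comp (comp h g) f }.

Arguments idm {_} _.

Notation "g ∘ f" := (comp g f) (at level 40, left associativity) : cat_scope.

Definition is_iso (C : category) (a b : C) (f : hom a b) :=
  exists g : hom b a, g ∘ f = idm a /\ f ∘ g = idm b.

Record functor (C D : category) := Functor {
  fobj :> C -> D;
  fmap : forall a b, hom a b -> hom (fobj a) (fobj b);
  fmap1 : forall a, fmap (idm a) = idm (fobj a);
  fmapM : forall a b c (g : hom b c) (f : hom a b),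
    fmap (g ∘ f) = fmap g ∘ fmap f }.

Record nattrans (C D : category) (F G : functor C D) := NatTrans {
  ncomp :> forall a, hom (F a) (G a);
  ncompE : forall a b (f : hom a b), ncomp b ∘ fmap F f = fmap G f ∘ ncomp a }.

Definition finite_category (J : category) : Prop :=
  (exists s : seq J, forall x, List.In x s) /\
  (forall x y : J, exists s : seq (hom x y), forall f, List.In f s).

Record cone (J C : category) (D : functor J C) := Cone {
  apex : C;
  leg : forall j, hom apex (D j);
  legE : forall i j (u : hom i j), fmap D u ∘ leg i = leg j }.

Definition is_limit (J C : category) (D : functor J C) (L : cone D) : Prop :=
  forall M : cone D,
    exists! u : hom (apex M) (apex L), forall j, leg L j ∘ u = leg M j.

Definition has_finite_limits (C : category) : Prop :=
  forall J : category, finite_category J ->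
  forall D : functor J C, exists L : cone D, is_limit L.

Definition P_epi (C : category) (P : C -> Prop) (x y : C) (f : hom x y) : Prop :=
  forall q, P q -> forall v : hom q y, exists u : hom q x, f ∘ u = v.

Definition projective_class (C : category) (P : C -> Prop) : Prop :=
  forall c, exists p, P p /\ exists f : hom p c, P_epi P f.

(* The choice operator that is part of GRing.Zmodule is no restriction: boolp
   puts one on every type. *)
Record zcategory := ZCategory {
  zcat :> category;
  zhom : forall a b : zcat, GRing.Zmodule (hom a b) }.

HB.instance Definition _ (B : zcategory) (a b : B) := zhom a b.

Record preadditive := Preadditive {
  pacat :> zcategory;
  compDl : forall (a b c : pacat) (g g' : hom b c) (f : hom a b),
    ((g + g') ∘ f = g ∘ f + g' ∘ f)%R;
  compDr : forall (a b c : pacat) (g : hom b c) (f f' : hom a b),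
    (g ∘ (f + f') = g ∘ f + g ∘ f')%R }.

Definition is_zero_object (C : category) (z : C) : Prop :=
  forall a : C, (exists! f : hom z a, True) /\ (exists! f : hom a z, True).

Definition is_product (C : category) (a b p : C) (u : hom p a) (v : hom p b) :=
  forall x (f : hom x a) (g : hom x b),
    exists! h : hom x p, u ∘ h = f /\ v ∘ h = g.

Definition mono (C : category) (a b : C) (f : hom a b) : Prop :=
  forall x (u v : hom x a), f ∘ u = f ∘ v -> u = v.

Definition epi (C : category) (a b : C) (f : hom a b) : Prop :=
  forall x (u v : hom b x), u ∘ f = v ∘ f -> u = v.

Definition is_kernel (B : preadditive) (a b k : B) (f : hom a b) (i : hom k a) :=
  (f ∘ i = 0)%R /\
  forall x (g : hom x a), (f ∘ g = 0)%R -> exists! h : hom x k, i ∘ h = g.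

Definition is_cokernel (B : preadditive) (a b q : B) (f : hom a b)
    (p : hom b q) :=
  (p ∘ f = 0)%R /\
  forall x (g : hom b x), (g ∘ f = 0)%R -> exists! h : hom q x, h ∘ p = g.

Record abelian := Abelian {
  abcat :> preadditive;
  ab_zero : exists z : abcat, is_zero_object z;
  ab_product : forall a b : abcat,
    exists p (u : hom p a) (v : hom p b), is_product u v;
  ab_kernel : forall (a b : abcat) (f : hom a b),
    exists k (i : hom k a), is_kernel f i;
  ab_cokernel : forall (a b : abcat) (f : hom a b),
    exists q (p : hom b q), is_cokernel f p;
  ab_mono : forall (a b : abcat) (f : hom a b), mono f ->
    exists c (g : hom b c), is_kernel g f;
  ab_epi : forall (a b : abcat) (f : hom a b), epi f ->
    exists c (g : hom c a), is_cokernel g f }.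

Section PreadditiveLemmas.
Local Open Scope ring_scope.
Variable B : preadditive.
Implicit Types a b c : B.

Lemma comp0m a b c (f : hom a b) : (0 : hom b c) ∘ f = 0.
Proof. by apply: (addrI (0 ∘ f)); rewrite -compDl !addr0. Qed.

Lemma compm0 a b c (g : hom b c) : g ∘ (0 : hom a b) = 0.
Proof. by apply: (addrI (g ∘ 0)); rewrite -compDr !addr0. Qed.

Lemma compNm a b c (g : hom b c) (f : hom a b) : (- g) ∘ f = - (g ∘ f).
Proof. by apply: (addrI (g ∘ f)); rewrite -compDl !subrr comp0m. Qed.

Lemma compmN a b c (g : hom b c) (f : hom a b) : g ∘ (- f) = - (g ∘ f).
Proof. by apply: (addrI (g ∘ f)); rewrite -compDr !subrr compm0. Qed.

Lemma compBl a b c (g g' : hom b c) (f : hom a b) :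
  (g - g') ∘ f = g ∘ f - g' ∘ f.
Proof. by rewrite compDl compNm. Qed.

Lemma compBr a b c (g : hom b c) (f f' : hom a b) :
  g ∘ (f - f') = g ∘ f - g ∘ f'.
Proof. by rewrite compDr compmN. Qed.

Lemma comp_suml a b c (I : Type) (r : seq I) (Q : pred I)
    (g : I -> hom b c) (f : hom a b) :
  (\sum_(i <- r | Q i) g i) ∘ f = \sum_(i <- r | Q i) (g i ∘ f).
Proof.
by apply: (big_morph (fun h => h ∘ f)) => [x y|]; rewrite ?compDl ?comp0m.
Qed.

Lemma comp_sumr a b c (I : Type) (r : seq I) (Q : pred I)
    (g : hom b c) (f : I -> hom a b) :
  g ∘ (\sum_(i <- r | Q i) f i) = \sum_(i <- r | Q i) (g ∘ f i).
Proof.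
by apply: (big_morph (fun h => g ∘ h)) => [x y|]; rewrite ?compDr ?compm0.
Qed.

Lemma signz (V : zmodType) (x : V) (n : nat) :
  x *~ (-1) ^+ n = if odd n then - x else x.
Proof. by rewrite -signr_odd; case: (odd n); rewrite ?expr1 ?expr0 ?mulrN1z ?mulr1z. Qed.

Lemma compsl a b c (g : hom b c) (f : hom a b) n :
  (g *~ (-1) ^+ n) ∘ f = (g ∘ f) *~ (-1) ^+ n.
Proof. by rewrite !signz; case: odd; rewrite ?compNm. Qed.

Lemma compsr a b c (g : hom b c) (f : hom a b) n :
  g ∘ (f *~ (-1) ^+ n) = (g ∘ f) *~ (-1) ^+ n.
Proof. by rewrite !signz; case: odd; rewrite ?compmN. Qed.

End PreadditiveLemmas.

(* Kernels and cokernels are selected with the choice operator of boolp. *)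
Section Kernels.
Variable B : abelian.

Definition kernel_data (a b : B) (f : hom a b) :
    {k : B & {i : hom k a | is_kernel f i}} :=
  let k := cid (ab_kernel f) in existT _ (sval k) (cid (svalP k)).

Definition ker (a b : B) (f : hom a b) : B := projT1 (kernel_data f).
Definition ker_map (a b : B) (f : hom a b) : hom (ker f) a :=
  sval (projT2 (kernel_data f)).

Lemma ker_mapP (a b : B) (f : hom a b) : is_kernel f (ker_map f).
Proof. exact: svalP. Qed.

Definition ker_lift (a b x : B) (f : hom a b) (g : hom x a)
    (fg0 : (f ∘ g = 0)%R) : hom x (ker f) :=
  sval (cid ((ker_mapP f).2 x g fg0)).

Lemma ker_liftE (a b x : B) (f : hom a b) (g : hom x a) (fg0 : (f ∘ g = 0)%R) :
  ker_map f ∘ ker_lift fg0 = g.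
Proof. by rewrite /ker_lift; case: cid => h []. Qed.

Lemma ker_map_mono (a b : B) (f : hom a b) : mono (ker_map f).
Proof.
move=> x u v uv; have [k0 kU] := ker_mapP f.
have /kU[h [_ hU]] : (f ∘ (ker_map f ∘ u) = 0)%R by rewrite compA k0 comp0m.
by rewrite -(hU u erefl) -(hU v (esym uv)).
Qed.

Definition cokernel_data (a b : B) (f : hom a b) :
    {q : B & {p : hom b q | is_cokernel f p}} :=
  let q := cid (ab_cokernel f) in existT _ (sval q) (cid (svalP q)).

Definition coker (a b : B) (f : hom a b) : B := projT1 (cokernel_data f).
Definition coker_map (a b : B) (f : hom a b) : hom b (coker f) :=
  sval (projT2 (cokernel_data f)).

Lemma coker_mapP (a b : B) (f : hom a b) : is_cokernel f (coker_map f).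
Proof. exact: svalP. Qed.

Definition coker_desc (a b x : B) (f : hom a b) (g : hom b x)
    (gf0 : (g ∘ f = 0)%R) : hom (coker f) x :=
  sval (cid ((coker_mapP f).2 x g gf0)).

Lemma coker_descE (a b x : B) (f : hom a b) (g : hom b x)
  (gf0 : (g ∘ f = 0)%R) : coker_desc gf0 ∘ coker_map f = g.
Proof. by rewrite /coker_desc; case: cid => h []. Qed.

Lemma coker_map_epi (a b : B) (f : hom a b) : epi (coker_map f).
Proof.
move=> x u v uv; have [k0 kU] := coker_mapP f.
have /kU[h [_ hU]] : (u ∘ coker_map f ∘ f = 0)%R by rewrite -compA k0 compm0.
by rewrite -(hU u erefl) -(hU v (esym uv)).
Qed.

(* The intersection of the subobjects Ker (f 1), ..., Ker (f n) of a, computed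
   by means of  M ∩ Ker f = Ker (f restricted to M). *)
Fixpoint ker_cap (a b : B) (f : nat -> hom a b) (n : nat) :
    {k : B & hom k a} :=
  if n is m.+1 then
    let k := ker_cap f m in
    existT (fun k => hom k a) (ker (f n ∘ projT2 k)) (projT2 k ∘ ker_map (f n ∘ projT2 k))
  else existT (fun k => hom k a) a (idm a).

Lemma ker_cap0 (a b : B) (f : nat -> hom a b) n i :
  0 < i <= n -> (f i ∘ projT2 (ker_cap f n) = 0)%R.
Proof.
elim: n => [|n IH] /=; first lia.
move=> lin; rewrite compA; have [->|ne] := eqVneq i n.+1.
  exact: (ker_mapP _).1.
by rewrite IH ?comp0m //; lia.
Qed.

Lemma ker_cap_mono (a b : B) (f : nat -> hom a b) n :
  mono (projT2 (ker_cap f n)).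
Proof.
elim: n => [|n IH] x u v /=; first by rewrite !comp1m.
by rewrite -!compA => /IH/ker_map_mono.
Qed.

Lemma ker_cap_lift (a b : B) (f : nat -> hom a b) n x (g : hom x a) :
  (forall i, 0 < i <= n -> (f i ∘ g = 0)%R) ->
  exists! h, projT2 (ker_cap f n) ∘ h = g.
Proof.
move=> fg0.
suff [h hE] : exists h, projT2 (ker_cap f n) ∘ h = g.
  by exists h; split => // h'; rewrite -hE => /esym/ker_cap_mono.
elim: n fg0 => [|n IH] fg0; first by exists g; rewrite comp1m.
have [|h hE] := IH; first by move=> i lin; apply: fg0; lia.
have h0 : (f n.+1 ∘ projT2 (ker_cap f n) ∘ h = 0)%R.
  by rewrite -compA hE fg0 //; lia.
by exists (ker_lift h0); rewrite /= -compA ker_liftE.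
Qed.

End Kernels.

Record chain_complex (B : preadditive) := ChainComplex {
  chain :> nat -> B;
  diff : forall n, hom (chain n.+1) (chain n);
  diff_sq : forall n, (diff n ∘ diff n.+1 = 0)%R }.

Record chain_map (B : preadditive) (K L : chain_complex B) := ChainMap {
  cmap :> forall n, hom (K n) (L n);
  cmapE : forall n, cmap n ∘ diff K n = diff L n ∘ cmap n.+1 }.

(* The differential leaving degree n; in degree 0 it is zero, and its kernel is
   then all of K 0. *)
Definition diff_out (B : preadditive) (K : chain_complex B) (n : nat) :
    hom (K n) (K n.-1) :=
  match n with 0 => 0%R | m.+1 => diff K m end.

Lemma diff_out_sq (B : preadditive) (K : chain_complex B) n :
  (diff_out K n ∘ diff K n = 0)%R.
Proof. by case: n => [|n] /=; rewrite ?comp0m ?diff_sq. Qed.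

Lemma cmap_out (B : preadditive) (K L : chain_complex B) (f : chain_map K L) n :
  f n.-1 ∘ diff_out K n = diff_out L n ∘ f n.
Proof. by case: n => [|n] /=; rewrite ?compm0 ?comp0m ?cmapE. Qed.

Section Homology.
Variable B : abelian.
Implicit Types K L M : chain_complex B.

Definition cycles K n : B := ker (diff_out K n).
Definition to_cycles K n : hom (K n.+1) (cycles K n) :=
  ker_lift (diff_out_sq K n).
Definition homology K n : B := coker (to_cycles K n).

Lemma cycles_map_subproof K L (f : chain_map K L) n :
  (diff_out L n ∘ (f n ∘ ker_map (diff_out K n)) = 0)%R.
Proof. by rewrite compA -cmap_out -compA (ker_mapP _).1 compm0. Qed.

Definition cycles_map K L (f : chain_map K L) n :
    hom (cycles K n) (cycles L n) :=
  ker_lift (cycles_map_subproof f n).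

Lemma cycles_mapE K L (f : chain_map K L) n :
  ker_map (diff_out L n) ∘ cycles_map f n = f n ∘ ker_map (diff_out K n).
Proof. exact: ker_liftE. Qed.

Lemma to_cyclesE K n : ker_map (diff_out K n) ∘ to_cycles K n = diff K n.
Proof. exact: ker_liftE. Qed.

Lemma homology_map_subproof K L (f : chain_map K L) n :
  (coker_map (to_cycles L n) ∘ cycles_map f n ∘ to_cycles K n = 0)%R.
Proof.
have -> : coker_map (to_cycles L n) ∘ cycles_map f n ∘ to_cycles K n =
          coker_map (to_cycles L n) ∘ (to_cycles L n ∘ f n.+1).
  rewrite -compA; congr (_ ∘ _); apply: (@ker_map_mono _ _ _ (diff_out L n)).
  by rewrite compA cycles_mapE -compA to_cyclesE compA to_cyclesE cmapE.
by rewrite compA (coker_mapP _).1 comp0m.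
Qed.

Definition homology_map K L (f : chain_map K L) n :
    hom (homology K n) (homology L n) :=
  coker_desc (homology_map_subproof f n).

Lemma homology_mapE K L (f : chain_map K L) n :
  homology_map f n ∘ coker_map (to_cycles K n) =
  coker_map (to_cycles L n) ∘ cycles_map f n.
Proof. exact: coker_descE. Qed.

Lemma homology_map_id K (f : chain_map K K) n :
  f n = idm (K n) -> homology_map f n = idm (homology K n).
Proof.
move=> fE; apply: coker_map_epi; rewrite homology_mapE comp1m -[RHS]compm1.
by congr (_ ∘ _); apply: ker_map_mono; rewrite cycles_mapE fE comp1m compm1.
Qed.

Lemma homology_map_comp K L M (g : chain_map L M) (f : chain_map K L)
    (h : chain_map K M) n :
  h n = g n ∘ f n -> homology_map h n = homology_map g n ∘ homology_map f n.
Proof.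
move=> hE; apply: coker_map_epi.
rewrite homology_mapE -compA homology_mapE compA homology_mapE -compA.
congr (_ ∘ _); apply: ker_map_mono.
by rewrite cycles_mapE compA cycles_mapE -compA cycles_mapE compA hE.
Qed.

Lemma homology_map_htpy K L (f g : chain_map K L) n
    (s : hom (K n) (L n.+1)) (t : hom (K n.-1) (L n)) :
  (f n - g n = diff L n ∘ s + t ∘ diff_out K n)%R ->
  homology_map f n = homology_map g n.
Proof.
move=> fgE; apply: coker_map_epi; rewrite !homology_mapE.
suff cE : (cycles_map f n =
           cycles_map g n + to_cycles L n ∘ (s ∘ ker_map (diff_out K n)))%R.
  by rewrite cE compDr [X in (_ + X)%R]compA (coker_mapP (to_cycles L n)).1 comp0m addr0.
apply: ker_map_mono; rewrite compDr !cycles_mapE [X in (_ + X)%R]compA to_cyclesE.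
apply/eqP; rewrite addrC -subr_eq -compBl fgE compDl -!compA.
by rewrite (ker_mapP _).1 compm0 addr0.
Qed.

End Homology.

(* [psface S n i] is the face ∂_i : S_{n+1} -> S_n.  It is meaningful only for
   i <= n.+1: its values for larger i are junk, which no axiom constrains and no
   construction below uses. *)
Record presimplicial (C : category) := Presimplicial {
  psobj :> nat -> C;
  psface : forall n, nat -> hom (psobj n.+1) (psobj n);
  psfaceE : forall n i j, i < j <= n.+2 ->
    psface n i ∘ psface n.+1 j = psface n j.-1 ∘ psface n.+1 i }.

Record ps_map (C : category) (S T : presimplicial C) := PsMap {
  psmap :> forall n, hom (S n) (T n);
  psmapE : forall n i, i <= n.+1 ->
    psmap n ∘ psface S n i = psface T n i ∘ psmap n.+1 }.

Definition ps_exact (C : category) (P : C -> Prop) (S : presimplicial C) (c : C)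
    (e : hom (S 0) c) : Prop :=
  forall q, P q ->
  [/\ forall y : hom q c, exists x : hom q (S 0), e ∘ x = y,
      forall x0 x1 : hom q (S 0), e ∘ x1 = e ∘ x0 ->
        exists x : hom q (S 1), psface S 0 0 ∘ x = x0 /\ psface S 0 1 ∘ x = x1
    & forall n (x : nat -> hom q (S n.+1)),
        (forall i j, i < j <= n.+2 ->
           psface S n i ∘ x j = psface S n j.-1 ∘ x i) ->
        exists y : hom q (S n.+2),
          forall i, i <= n.+2 -> psface S n.+1 i ∘ y = x i].

Record ps_resolution (C : category) (P : C -> Prop) (c : C) := PsResolution {
  psr_obj :> presimplicial C;
  psr_aug : hom (psr_obj 0) c;
  psr_augE : psr_aug ∘ psface psr_obj 0 0 = psr_aug ∘ psface psr_obj 0 1;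
  psr_exact : ps_exact P psr_aug;
  psr_proj : forall n, P (psr_obj n) }.

Definition ps_lifts (C : category) (P : C -> Prop) (c d : C)
    (S : ps_resolution P c) (T : ps_resolution P d) (f : hom c d)
    (u : ps_map S T) : Prop :=
  psr_aug T ∘ u 0 = f ∘ psr_aug S.

Section PsImage.
Variables (C D : category).

Lemma ps_image_subproof (F : functor C D) (S : presimplicial C) n i j :
  i < j <= n.+2 ->
  fmap F (psface S n i) ∘ fmap F (psface S n.+1 j) =
  fmap F (psface S n j.-1) ∘ fmap F (psface S n.+1 i).
Proof. by move=> ltij; rewrite -!fmapM psfaceE. Qed.

Definition ps_image (F : functor C D) (S : presimplicial C) : presimplicial D :=
  Presimplicial (ps_image_subproof F S).

Lemma ps_image_map_subproof (F : functor C D) (S T : presimplicial C)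
    (u : ps_map S T) n i : i <= n.+1 ->
  fmap F (u n) ∘ psface (ps_image F S) n i =
  psface (ps_image F T) n i ∘ fmap F (u n.+1).
Proof. by move=> lein; rewrite -!fmapM psmapE. Qed.

Definition ps_image_map (F : functor C D) (S T : presimplicial C)
    (u : ps_map S T) : ps_map (ps_image F S) (ps_image F T) :=
  @PsMap _ (ps_image F S) (ps_image F T) (fun n => fmap F (u n))
    (ps_image_map_subproof F u).

Lemma ps_image_nat_subproof (F G : functor C D) (t : nattrans F G)
    (S : presimplicial C) n i : i <= n.+1 ->
  t (S n) ∘ psface (ps_image F S) n i = psface (ps_image G S) n i ∘ t (S n.+1).
Proof. by move=> _; rewrite ncompE. Qed.

Definition ps_image_nat (F G : functor C D) (t : nattrans F G)
    (S : presimplicial C) : ps_map (ps_image F S) (ps_image G S) :=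
  @PsMap _ (ps_image F S) (ps_image G S) (fun n => t (S n))
    (ps_image_nat_subproof t S).

End PsImage.

Section AlternatingSums.
Local Open Scope ring_scope.

Lemma alt_sum_sq (B : preadditive) (a b c : B) (d : nat -> hom b c)
    (e : nat -> hom a b) (m : nat) :
  (forall i j, (i < j <= m)%N -> d i ∘ e j = d j.-1 ∘ e i) ->
  (\sum_(i < m) d i *~ (-1) ^+ i) ∘ (\sum_(j < m.+1) e j *~ (-1) ^+ j) = 0.
Proof.
move=> de; pose E i j : hom a c := (d i ∘ e j) *~ (-1) ^+ (i + j)%N.
have -> : (\sum_(i < m) d i *~ (-1) ^+ i) ∘ (\sum_(j < m.+1) e j *~ (-1) ^+ j) =
    \sum_(j < m.+1) \sum_(i < m) E i j.
  rewrite comp_sumr; apply: eq_bigr => j _; rewrite compsr comp_suml.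
  rewrite mulrz_suml; apply: eq_bigr => i _.
  by rewrite compsl -mulrzA -exprD.
have EN i j : (i <= j < m)%N -> E i j.+1 = - E j i.
  move=> lij; rewrite /E de ?signz /=; last lia.
  by rewrite addnS /= addnC; case: odd; rewrite ?opprK.
transitivity (\sum_(j < m.+1) (\sum_(i < m | (i < j)%N) E i j +
                               \sum_(i < m | ~~ (i < j)%N) E i j)).
  by apply: eq_bigr => j _; rewrite [LHS](bigID (fun i : 'I_m => (i < j)%N)).
rewrite big_split /= big_ord_recl [X in X + _ + _]big_pred0 ?add0r //.
rewrite [X in _ + X]big_ord_recr /= [X in _ + (_ + X)]big_pred0 ?addr0; last first.
  by move=> i; rewrite ltn_ord.
rewrite [X in _ + X](exchange_big_dep predT) //= -big_split /= big1 // => j _.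
rewrite (eq_bigr (fun i : 'I_m => - E j i)); last first.
  by move=> i lij; rewrite EN //; have := ltn_ord j; move: lij => /=; rewrite /bump; lia.
rewrite sumrN; apply/eqP; rewrite addrC subr_eq0; apply/eqP.
by apply: eq_bigl => i; rewrite /= /bump; lia.
Qed.

Lemma alt_sum_htpy (V : zmodType) (D G : nat -> nat -> V) (m : nat) :
  (forall i j, (i < j <= m)%N -> D i j = - G i j.-1) ->
  (forall i j, (j.+1 < i <= m.+1)%N -> D i j = - G i.-1 j) ->
  \sum_(j < m.+1) \sum_(i < m.+2) D i j =
  \sum_(j < m.+1) (D j j + D j.+1 j) - \sum_(j < m) \sum_(i < m.+1) G i j.
Proof.
move=> Dlt Dgt.
have split_j (j : 'I_m.+1) : \sum_(i < m.+2) D i j =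
    D j j + D j.+1 j + (\sum_(i < m.+2 | (i < j)%N) D i j +
                        \sum_(i < m.+2 | (j.+1 < i)%N) D i j).
  have lj := ltn_ord j.
  rewrite (bigD1 (inord j)) //= (bigD1 (inord j.+1)) /=; last first.
    by rewrite -val_eqE /= !inordK; lia.
  rewrite !inordK; try lia.
  rewrite addrA; congr (_ + _).
  rewrite (bigID (fun i : 'I_m.+2 => (i < j)%N)) /=; congr (_ + _);
    apply: eq_bigl => i; rewrite -!val_eqE /= !inordK; lia.
rewrite (eq_bigr _ (fun j _ => split_j j)) big_split /=; congr (_ + _).
rewrite big_split /= -sumrN.
rewrite [X in X + _]big_ord_recl [X in X + _ + _]big_pred0 ?add0r //.
rewrite [X in _ + X]big_ord_recr /= [X in _ + (_ + X)]big_pred0 ?addr0; last first.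
  by move=> i; have := ltn_ord i; lia.
rewrite -big_split /=; apply: eq_bigr => j _; have lj := ltn_ord j.
rewrite (bigID (fun i : 'I_m.+1 => (i <= j)%N)) opprD /=.
congr (_ + _).
  rewrite big_mkcond big_ord_recr /= [X in _ + X]ifF ?addr0; last first.
    by rewrite /bump; lia.
  rewrite -big_mkcond -sumrN /=; apply: eq_big => [i|i]; rewrite /bump /=; first lia.
  by move=> lij; rewrite Dlt //; lia.
rewrite big_mkcond big_ord_recl /= add0r -big_mkcond -sumrN.
apply: eq_big => [i|i]; rewrite /bump /=; first lia.
by move=> lij; rewrite Dgt; [|have := ltn_ord i; lia].
Qed.

End AlternatingSums.

Section PsComplex.
Local Open Scope ring_scope.
Variable B : preadditive.
Implicit Types S T : presimplicial B.

Definition ps_diff S n : hom (S n.+1) (S n) :=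
  \sum_(i < n.+2) psface S n i *~ (-1) ^+ i.

Lemma ps_diff_sq S n : ps_diff S n ∘ ps_diff S n.+1 = 0.
Proof. by apply: alt_sum_sq => i j lij; rewrite psfaceE. Qed.

Definition ps_complex S : chain_complex B := ChainComplex (ps_diff_sq S).

Lemma ps_complex_map_subproof S T (u : ps_map S T) n :
  u n ∘ ps_diff S n = ps_diff T n ∘ u n.+1.
Proof.
rewrite comp_sumr comp_suml; apply: eq_bigr => i _.
by rewrite compsr compsl psmapE // -ltnS.
Qed.

Definition ps_complex_map S T (u : ps_map S T) :
    chain_map (ps_complex S) (ps_complex T) :=
  @ChainMap _ (ps_complex S) (ps_complex T) u (ps_complex_map_subproof u).

End PsComplex.

(* A presimplicial homotopy h; the k n j are the common values of consecutive
   faces of the h n j. *)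
Lemma ps_htpy_homology (B : abelian) (S T : presimplicial B) (f g : ps_map S T)
    (k : forall n, nat -> hom (S n) (T n))
    (h : forall n, nat -> hom (S n) (T n.+1)) :
  (forall n, k n 0 = f n) -> (forall n, k n n.+1 = g n) ->
  (forall n j, j <= n -> psface T n j ∘ h n j = k n j) ->
  (forall n j, j <= n -> psface T n j.+1 ∘ h n j = k n j.+1) ->
  (forall n i j, i < j <= n.+1 ->
     psface T n.+1 i ∘ h n.+1 j = h n j.-1 ∘ psface S n i) ->
  (forall n i j, j.+1 < i <= n.+2 ->
     psface T n.+1 i ∘ h n.+1 j = h n j ∘ psface S n i.-1) ->
  forall n, homology_map (ps_complex_map f) n = homology_map (ps_complex_map g) n.
Proof.
move=> kf kg hk0 hk1 hlt hgt n.
pose s m : hom (S m) (T m.+1) := (\sum_(j < m.+1) h m j *~ (-1) ^+ j)%R.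
have dsE m : (ps_diff T m ∘ s m = \sum_(j < m.+1) \sum_(i < m.+2)
      (psface T m i ∘ h m j) *~ (-1) ^+ (i + j)%N)%R.
  rewrite comp_sumr; apply: eq_bigr => j _; rewrite compsr comp_suml.
  rewrite mulrz_suml; apply: eq_bigr => i _.
  by rewrite compsl -mulrzA -exprD.
have tele m : (\sum_(j < m.+1)
      ((psface T m j ∘ h m j) *~ (-1) ^+ (j + j)%N +
       (psface T m j.+1 ∘ h m j) *~ (-1) ^+ (j.+1 + j)%N) = f m - g m)%R.
  rewrite (eq_bigr (fun j : 'I_m.+1 => k m j - k m j.+1)%R) => [|j _].
    rewrite -kf -kg -(big_mkord xpredT (fun j => k m j - k m j.+1)%R).
    rewrite (telescope_sumr_eq (fun j => - k m j)%R) // => [|j _].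
      by rewrite opprK addrC.
    by rewrite opprK addrC.
  have lj : j <= m by rewrite -ltnS.
  by rewrite !signz /= addnn odd_double /= hk0 ?hk1.
case: n => [|n].
  apply: (@homology_map_htpy B (ps_complex S) (ps_complex T) (ps_complex_map f)
    (ps_complex_map g) 0 (s 0) 0%R) => /=.
  rewrite comp0m addr0 dsE -tele !big_ord1 !big_ord_recl big_ord0 /= addr0.
  by rewrite /bump.
apply: (@homology_map_htpy B (ps_complex S) (ps_complex T) (ps_complex_map f)
  (ps_complex_map g) n.+1 (s n.+1) (s n)) => /=.
pose D i j := ((psface T n.+1 i ∘ h n.+1 j) *~ (-1) ^+ (i + j)%N)%R.
pose G i j := ((h n j ∘ psface S n i) *~ (-1) ^+ (i + j)%N)%R.
rewrite dsE (@alt_sum_htpy _ D G) ?tele.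
- rewrite -addrA -[LHS]addr0; congr (_ + _)%R; apply/esym/eqP.
  rewrite addrC subr_eq0; apply/eqP.
  rewrite comp_suml; apply: eq_bigr => j _; rewrite compsl comp_sumr.
  rewrite mulrz_suml; apply: eq_bigr => i _.
  by rewrite compsr -mulrzA -exprD.
- move=> i [|j] lij; rewrite /D /G ?hlt //= !signz addnS /=.
  by case: odd; rewrite ?opprK.
- move=> [|i] j lij; rewrite /D /G ?hgt //= !signz /=.
  by case: odd; rewrite ?opprK.
Qed.

Lemma dependent_tower (T : nat -> Type) (R : forall n, T n -> T n.+1 -> Prop) :
  (forall n x y, R n x y -> exists z, R n.+1 y z) ->
  forall x0 x1, R 0 x0 x1 ->
  exists t : forall n, T n, t 0 = x0 /\ forall n, R n (t n) (t n.+1).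
Proof.
move=> step x0 x1 R01.
pose state n := {p : T n * T n.+1 | R n p.1 p.2}.
pose next n (s : state n) : state n.+1 :=
  let z := cid (step n _ _ (svalP s)) in
  exist (fun p => R n.+1 p.1 p.2) ((sval s).2, sval z) (svalP z).
pose st : forall n, state n := fix st n :=
  if n is m.+1 then next m (st m)
  else exist (fun p : T 0 * T 1 => R 0 p.1 p.2) (x0, x1) R01.
exists (fun n => (sval (st n)).1); split => // n; exact: (svalP (st n)).
Qed.

Section PsAugmented.
Variables (C : category) (P : C -> Prop) (c : C) (S : ps_resolution P c).

(* The augmented object with degrees shifted by one: S_{-1} = c is in degree 0. *)
Definition aug_obj n : C := if n is m.+1 then S m else c.
Definition aug_face n : nat -> hom (aug_obj n.+1) (aug_obj n) :=
  match n with 0 => fun=> psr_aug S | m.+1 => psface S m end.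

Lemma aug_faceE n i j : i < j <= n.+1 ->
  aug_face n i ∘ aug_face n.+1 j = aug_face n j.-1 ∘ aug_face n.+1 i.
Proof.
case: n => [|n] lij /=; last exact: psfaceE.
have [-> ->] : i = 0 /\ j = 1 by lia.

exact: esym (psr_augE S).
Qed.

Lemma aug_exact0 q (x : hom q (aug_obj 0)) : P q ->
  exists y, aug_face 0 0 ∘ y = x.
Proof. by move=> /(psr_exact S)[/(_ x)]. Qed.

Lemma aug_exactS q n (x : nat -> hom q (aug_obj n.+1)) : P q ->
  (forall i j, i < j <= n.+1 -> aug_face n i ∘ x j = aug_face n j.-1 ∘ x i) ->
  exists y, forall i, i <= n.+1 -> aug_face n.+1 i ∘ y = x i.
Proof.
move=> /(psr_exact S)[_ ex1 exn].
case: n x => [|n] x xE; last exact: exn.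
have [|y [y0 y1]] := ex1 (x 0) (x 1); first exact: (xE 0 1).
by exists y; case=> [|[|i]].
Qed.

End PsAugmented.

Section PsComparison.
Variables (C : category) (P : C -> Prop) (c d : C).
Variables (S : ps_resolution P c) (T : ps_resolution P d).

Lemma ps_lift_exists (f : hom c d) : exists u : ps_map S T, ps_lifts f u.
Proof.
pose R n (u : hom (aug_obj S n) (aug_obj T n))
  (v : hom (aug_obj S n.+1) (aug_obj T n.+1)) :=
  forall i, i <= n -> u ∘ aug_face S n i = aug_face T n i ∘ v.
have [u1 u1E] := @aug_exact0 _ _ _ T (S 0) (f ∘ psr_aug S) (psr_proj S 0).
have step n u v : R n u v -> exists w, R n.+1 v w.
  move=> uv; have [|w wE] := @aug_exactS _ _ _ T (S n.+1) n
    (fun i => v ∘ aug_face S n.+1 i) (psr_proj S _); last first.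
    by exists w => i lin; rewrite wE.
  move=> i j lij; rewrite !compA -!uv; try lia.
  by rewrite -!compA aug_faceE.
have [|t [t0 tE]] := dependent_tower step (x0 := f : hom (aug_obj S 0) (aug_obj T 0)) (x1 := u1).
  by move=> i _; rewrite [LHS]/= -u1E.
exists (PsMap (fun n i => tE n.+1 i : i <= n.+1 -> _)).
by have := tE 0 0 (leqnn 0); rewrite t0.
Qed.

Variables (f : hom c d) (u v : ps_map S T).
Hypotheses (uf : ps_lifts f u) (vf : ps_lifts f v).

Let au n : hom (aug_obj S n) (aug_obj T n) :=
  match n with 0 => f | m.+1 => u m end.
Let av n : hom (aug_obj S n) (aug_obj T n) :=
  match n with 0 => f | m.+1 => v m end.

Let auE n i : i <= n -> aug_face T n i ∘ au n.+1 = au n ∘ aug_face S n i.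
Proof. by case: n => [|n] lin //=; rewrite psmapE. Qed.
Let avE n i : i <= n -> aug_face T n i ∘ av n.+1 = av n ∘ aug_face S n i.
Proof. by case: n => [|n] lin //=; rewrite psmapE. Qed.

Let hk_exists : exists k : forall n, nat -> hom (aug_obj S n) (aug_obj T n),
  [/\ forall n, k n 0 = au n, forall n, k n n = av n &
      forall n i j, i <= n -> j <= n.+1 -> aug_face T n i ∘ k n.+1 j =
        (if i < j then k n j.-1 else k n j) ∘ aug_face S n i].
Proof.
pose R n (k : nat -> hom (aug_obj S n) (aug_obj T n))
    (l : nat -> hom (aug_obj S n.+1) (aug_obj T n.+1)) :=
  [/\ k 0 = au n, k n = av n, l 0 = au n.+1, l n.+1 = av n.+1 &
      forall i j, i <= n -> j <= n.+1 -> aug_face T n i ∘ l j =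
        (if i < j then k j.-1 else k j) ∘ aug_face S n i].
have step n k l : R n k l -> exists m, R n.+1 l m.
  case=> k0 kn l0 ln klE.
  have /choice[m mE] : forall j, exists y, [/\ j = 0 -> y = au n.+2,
      j = n.+2 -> y = av n.+2 & forall i, i <= n.+1 -> j <= n.+2 ->
      aug_face T n.+1 i ∘ y =
        (if i < j then l j.-1 else l j) ∘ aug_face S n.+1 i].
    move=> j; have [->|jn0] := eqVneq j 0.
      by exists (au n.+2); split=> // i lin _; rewrite auE // ltn0 l0.
    have [->|jn] := eqVneq j n.+2.
      by exists (av n.+2); split=> // i lin _; rewrite avE // ltnS lin ln.
    have [lj|lj] := leqP j n.+2; last first.
      by exists (au n.+2); split => //; lia.
    have [|y yE] := @aug_exactS _ _ _ T (S n.+1) n (fun i =>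
       (if i < j then l j.-1 else l j) ∘ aug_face S n.+1 i) (psr_proj S _).
      move=> i i' lii; rewrite !compA.
      have E b : (if b then l j.-1 else l j) = l (if b then j.-1 else j) by case: b.
      rewrite !E !klE; try lia; try by case: ifP; lia.
      rewrite -!compA aug_faceE //; congr (_ ∘ _).
      have E' (b : bool) x : (if b then k x.-1 else k x) = k (if b then x.-1 else x) by case: b.
      rewrite !E'; congr (k _).
      by do !case: ifP; lia.
    exists y; split; [by move/eqP: jn0|by move/eqP: jn|].
    by move=> i lin _; rewrite yE.
  exists m; split => //; first by have [/(_ erefl)] := mE 0.
    by have [_ /(_ erefl)] := mE n.+2.
  by move=> i j lin ljn; have [_ _] := mE j; apply.
have [|k [k0 kE]] := dependent_tower step
   (x0 := fun=> au 0) (x1 := fun j => if j is 0 then au 1 else av 1).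
  split=> // i [|[|j]] //; rewrite leqn0 => /eqP-> _.
  exact: (@avE 0 0 isT).
by exists k; split=> n; case: (kE n).
Qed.

Lemma ps_lift_unique (B : abelian) (F : functor C B) n :
  homology_map (ps_complex_map (ps_image_map F u)) n =
  homology_map (ps_complex_map (ps_image_map F v)) n.
Proof.
have [k [k0 kn kE]] := hk_exists.
(* There is no homotopy operator in degree -1: the tower starts at unit. *)
pose X n : Type :=
  if n is m.+1 then nat -> hom (aug_obj S n) (aug_obj T n.+1) else unit.
pose hd : forall n, X n -> nat -> nat -> hom (aug_obj S n.+1) (aug_obj T n.+1) :=
  fun n => match n with
    | 0 => fun _ _ _ => k 1 0
    | m.+1 => fun h p i => h p ∘ aug_face S m.+1 i
    end.
have hdE m (h : X m) p a b : 0 < m -> a < b <= m.+1 ->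
    hd m h p a ∘ aug_face S m.+1 b = hd m h p b.-1 ∘ aug_face S m.+1 a.
  by case: m h => // m h _ lab; rewrite /= -!compA (aug_faceE S lab).
pose R n (h : X n) (l : X n.+1) :=
  forall i j, i <= n.+1 -> j <= n -> aug_face T n.+1 i ∘ l j =
    if i < j then hd n h j.-1 i else
    if i == j then k n.+1 j else
    if i == j.+1 then k n.+1 j.+1 else hd n h j i.-1.
have [l0 R0] : exists l, R 0 tt l.
  have [|y yE] := @aug_exactS _ _ _ T (S 0) 0 (k 1) (psr_proj S _).
    move=> i j lij; have [-> ->] : i = 0 /\ j = 1 by lia.
    by rewrite (kE 0 0 1) // (kE 0 0 0).
  exists (fun=> y) => i [|//] li _; rewrite yE //.
  by case: i li => [|[|]].
have step m h l : R m h l -> exists w, R m.+1 l w.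
  move=> hl.
  pose spec i j (y : hom (aug_obj S m.+2) (aug_obj T m.+3)) :=
      aug_face T m.+2 i ∘ y =
      if i < j then l j.-1 ∘ aug_face S m.+1 i else
      if i == j then k m.+2 j else
      if i == j.+1 then k m.+2 j.+1 else l j ∘ aug_face S m.+1 i.-1.
  suff ex j : j <= m.+1 -> exists y, forall i, i <= m.+2 -> spec i j y.
    have /choice[w wE] : forall j, exists y,
        forall i, i <= m.+2 -> spec i (minn j m.+1) y.
      by move=> j; apply: ex; apply: geq_minr.
    exists w => i j li lj; rewrite -/(spec i j _).
    by have := wE j i li; rewrite (minn_idPl lj).
  move=> lj; pose x i := if i < j then l j.-1 ∘ aug_face S m.+1 i else
      if i == j then k m.+2 j else
      if i == j.+1 then k m.+2 j.+1 else l j ∘ aug_face S m.+1 i.-1.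
  apply: (@aug_exactS _ _ _ T _ m.+1 x); first exact: (psr_proj S).
  have x1 i : i < j -> x i = l j.-1 ∘ aug_face S m.+1 i by rewrite /x => ->.
  have x2 : x j = k m.+2 j by rewrite /x ltnn eqxx.
  have x3 : x j.+1 = k m.+2 j.+1.
    by rewrite /x ltnNge leqnSn gtn_eqF //= eqxx.
  have x4 i : j.+1 < i -> x i = l j ∘ aug_face S m.+1 i.-1.
    by move=> ji; rewrite /x ltnNge ltnW 1?ltnW //= !gtn_eqF // ltnW.
  have h1 i p : i < p <= m ->
      aug_face T m.+1 i ∘ l p = hd m h p.-1 i.
    by move=> ip; rewrite hl ?ifT //; lia.
  have h2 p : p <= m -> aug_face T m.+1 p ∘ l p = k m.+1 p.
    by move=> pm; rewrite hl ?ltnn ?eqxx //; lia.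
  have h3 p : p <= m -> aug_face T m.+1 p.+1 ∘ l p = k m.+1 p.+1.
    by move=> pm; rewrite hl // ltnNge leqnSn gtn_eqF //= eqxx.
  have h3' p : 0 < p <= m.+1 -> aug_face T m.+1 p ∘ l p.-1 = k m.+1 p.
    by case: p => // p; apply: h3.
  have h4 i p : p.+1 < i <= m.+1 ->
      aug_face T m.+1 i ∘ l p = hd m h p i.-1.
    by move=> ip; rewrite hl ?ifF //; lia.
  have k1 i p : i < p <= m.+2 ->
      aug_face T m.+1 i ∘ k m.+2 p = k m.+1 p.-1 ∘ aug_face S m.+1 i.
    by move=> ip; rewrite kE ?ifT //; lia.
  have k2 i p : p <= i <= m.+1 ->
      aug_face T m.+1 i ∘ k m.+2 p = k m.+1 p ∘ aug_face S m.+1 i.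
    by move=> ip; rewrite kE ?ifF //; lia.
  move=> a b lab; have [aj|ja] := ltnP a j.
    rewrite [x a]x1 // compA.
    have [bj|jb|bj] := ltngtP b j.
    - rewrite x1 // compA h1 ?h1; try lia.
      by rewrite hdE //; lia.
    - have [->|bj] := eqVneq b j.+1.
        by rewrite x3 k1 ?h3' //; lia.
      rewrite x4 ?compA; last lia.
      rewrite h1 ?h4; try lia.
      by rewrite hdE //; lia.
    - by rewrite bj x2 k1 ?h2; try lia.
  have [->|aj] := eqVneq a j.
    rewrite x2; have [->|bj] := eqVneq b j.+1.
      by rewrite x3 k1 ?k2; try lia.
    by rewrite x4 ?compA ?h2 ?k2; try lia.
  have [->|aj1] := eqVneq a j.+1.
    by rewrite x3 x4 ?compA ?h3 ?k2; try lia.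
  rewrite !x4 ?compA ?h4; try lia.
  by rewrite hdE //; lia.
have [h [_ hE]] := dependent_tower step R0.
pose hS n : nat -> hom (S n) (T n.+1) := h n.+1.
apply: (@ps_htpy_homology B (ps_image F S) (ps_image F T) (ps_image_map F u)
  (ps_image_map F v) (fun n j => fmap F (k n.+1 j))
  (fun n j => fmap F (hS n j))) => /= m.
- by rewrite k0.
- by rewrite kn.
- move=> j lj; rewrite -fmapM; congr (fmap F _).
  by rewrite (hE m) ?ltnn ?eqxx //; lia.
- move=> j lj; rewrite -fmapM; congr (fmap F _).
  by rewrite (hE m) // ltnNge leqnSn gtn_eqF //= eqxx.
- move=> i j lij; rewrite -!fmapM; congr (fmap F _).
  by rewrite (hE m.+1) ?ifT //; lia.
- move=> i j lij; rewrite -!fmapM; congr (fmap F _).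
  by rewrite (hE m.+1) ?ifF //; lia.
Qed.

End PsComparison.

Definition ps_comp (C : category) (S T U : presimplicial C) (v : ps_map T U)
    (u : ps_map S T) : ps_map S U.
Proof.
exists (fun n => v n ∘ u n) => n i lin.
by rewrite -compA psmapE // !compA psmapE.
Defined.

Definition ps_id (C : category) (S : presimplicial C) : ps_map S S.
Proof. by exists (fun n => idm (S n)) => n i _; rewrite comp1m compm1. Defined.

Section SimplicialDerived.
Variables (C : category) (P : C -> Prop) (S : forall c, ps_resolution P c).
Variables (B : abelian) (n : nat).

Definition ps_lift (c d : C) (f : hom c d) : ps_map (S c) (S d) :=
  sval (cid (ps_lift_exists (S c) (S d) f)).

Lemma ps_liftP (c d : C) (f : hom c d) : ps_lifts f (ps_lift f).
Proof. exact: svalP. Qed.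

Definition simplicial_derived_obj (F : functor C B) (c : C) : B :=
  homology (ps_complex (ps_image F (S c))) n.

Definition simplicial_derived_map (F : functor C B) (c d : C) (f : hom c d) :
    hom (simplicial_derived_obj F c) (simplicial_derived_obj F d) :=
  homology_map (ps_complex_map (ps_image_map F (ps_lift f))) n.

Lemma simplicial_derived_mapE (F : functor C B) (c d : C) (f : hom c d)
    (u : ps_map (S c) (S d)) : ps_lifts f u ->
  simplicial_derived_map F f = homology_map (ps_complex_map (ps_image_map F u)) n.
Proof. by move=> uf; apply: (ps_lift_unique (ps_liftP f) uf). Qed.

Lemma simplicial_derived_map1 (F : functor C B) (c : C) :
  simplicial_derived_map F (idm c) = idm (simplicial_derived_obj F c).
Proof.
rewrite (@simplicial_derived_mapE _ _ _ _ (ps_id (S c))); last first.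
  by rewrite /ps_lifts /= compm1 comp1m.
by apply: homology_map_id; rewrite /= fmap1.
Qed.

Lemma simplicial_derived_mapM (F : functor C B) (a b c : C) (g : hom b c)
    (f : hom a b) :
  simplicial_derived_map F (g ∘ f) =
  simplicial_derived_map F g ∘ simplicial_derived_map F f.
Proof.
rewrite (@simplicial_derived_mapE _ _ _ _ (ps_comp (ps_lift g) (ps_lift f))).
  by apply: homology_map_comp; rewrite /= fmapM.
by rewrite /ps_lifts /= compA ps_liftP -!compA ps_liftP.
Qed.

Definition simplicial_derived (F : functor C B) : functor C B :=
  Functor (simplicial_derived_map1 F) (simplicial_derived_mapM F).

Lemma simplicial_derived_nat_subproof (F G : functor C B) (t : nattrans F G)
    (c d : C) (f : hom c d) :
  homology_map (ps_complex_map (ps_image_nat t (S d))) n ∘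
    fmap (simplicial_derived F) f =
  fmap (simplicial_derived G) f ∘
    homology_map (ps_complex_map (ps_image_nat t (S c))) n.
Proof.
pose u := ps_comp (ps_image_nat t (S d)) (ps_image_map F (ps_lift f)).
rewrite -(@homology_map_comp _ _ _ _ _ _ (ps_complex_map u)) //.
by apply: homology_map_comp; rewrite /= ncompE.
Qed.

Definition simplicial_derived_nat (F G : functor C B) (t : nattrans F G) :
    nattrans (simplicial_derived F) (simplicial_derived G) :=
  @NatTrans _ _ (simplicial_derived F) (simplicial_derived G)
    (fun c => homology_map (ps_complex_map (ps_image_nat t (S c))) n)
    (simplicial_derived_nat_subproof t).

End SimplicialDerived.

(* [pcface X n e i] is the face ∂_i^e : X_{n+1} -> X_n and [pcdegen X n i] the
   pseudodegeneracy s_i : X_n -> X_{n+1}, with e = false for 0 and e = true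
   for 1.  Indices range over 1 <= i <= n.+1; as for presimplicial objects, other
   values are unconstrained and unused. *)
Record pseudocubical (C : category) := Pseudocubical {
  pcobj :> nat -> C;
  pcface : forall n, bool -> nat -> hom (pcobj n.+1) (pcobj n);
  pcdegen : forall n, nat -> hom (pcobj n) (pcobj n.+1);
  pcface_face : forall n a e i j, [&& 0 < i, i < j & j <= n.+2] ->
    pcface n a i ∘ pcface n.+1 e j = pcface n e j.-1 ∘ pcface n.+1 a i;
  pcface_degen_lt : forall n a i j, [&& 0 < i, i < j & j <= n.+2] ->
    pcface n.+1 a i ∘ pcdegen n.+1 j = pcdegen n j.-1 ∘ pcface n a i;
  pcface_degen_eq : forall n a i, 0 < i <= n.+1 ->
    pcface n a i ∘ pcdegen n i = idm (pcobj n);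
  pcface_degen_gt : forall n a i j, [&& 0 < j, j < i & i <= n.+2] ->
    pcface n.+1 a i ∘ pcdegen n.+1 j = pcdegen n j ∘ pcface n a i.-1 }.

(* Compatibility with the pseudodegeneracies is not required. *)
Record precubical_map (C : category) (X Y : pseudocubical C) := PrecubicalMap {
  pcmap :> forall n, hom (X n) (Y n);
  pcmapE : forall n e i, 0 < i <= n.+1 ->
    pcmap n ∘ pcface X n e i = pcface Y n e i ∘ pcmap n.+1 }.

Definition pc_exact (C : category) (P : C -> Prop) (X : pseudocubical C) (c : C)
    (aug : hom (X 0) c) : Prop :=
  forall q, P q ->
  [/\ forall y : hom q c, exists x : hom q (X 0), aug ∘ x = y,
      forall x y : hom q (X 0), aug ∘ x = aug ∘ y ->
        exists z : hom q (X 1),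
          pcface X 0 false 1 ∘ z = x /\ pcface X 0 true 1 ∘ z = y
    & forall n (x : bool -> nat -> hom q (X n.+1)),
        (forall a e i j, [&& 0 < i, i < j & j <= n.+2] ->
           pcface X n a i ∘ x e j = pcface X n e j.-1 ∘ x a i) ->
        exists y : hom q (X n.+2),
          forall e i, 0 < i <= n.+2 -> pcface X n.+1 e i ∘ y = x e i].

Record pc_resolution (C : category) (P : C -> Prop) (c : C) := PcResolution {
  pcr_obj :> pseudocubical C;
  pcr_aug : hom (pcr_obj 0) c;
  pcr_augE : pcr_aug ∘ pcface pcr_obj 0 false 1 = pcr_aug ∘ pcface pcr_obj 0 true 1;
  pcr_exact : pc_exact P pcr_aug;
  pcr_proj : forall n, P (pcr_obj n) }.

Definition pc_lifts (C : category) (P : C -> Prop) (c d : C)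
    (X : pc_resolution P c) (Y : pc_resolution P d) (f : hom c d)
    (u : precubical_map X Y) : Prop :=
  pcr_aug Y ∘ u 0 = f ∘ pcr_aug X.

Definition pc_comp (C : category) (X Y Z : pseudocubical C)
    (v : precubical_map Y Z) (u : precubical_map X Y) : precubical_map X Z.
Proof.
exists (fun n => v n ∘ u n) => n e i lin.
by rewrite -compA pcmapE // !compA pcmapE.
Defined.

Definition pc_id (C : category) (X : pseudocubical C) : precubical_map X X.
Proof. by exists (fun n => idm (X n)) => n e i _; rewrite comp1m compm1. Defined.

Section PcImage.
Variables (C D : category).

Definition pc_image (F : functor C D) (X : pseudocubical C) : pseudocubical D.
Proof.
exists (fun n => F (X n)) (fun n e i => fmap F (pcface X n e i))
  (fun n i => fmap F (pcdegen X n i)) => *.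
- by rewrite -!fmapM pcface_face.
- by rewrite -!fmapM pcface_degen_lt.
- by rewrite -fmapM pcface_degen_eq // fmap1.
- by rewrite -!fmapM pcface_degen_gt.
Defined.

Definition pc_image_map (F : functor C D) (X Y : pseudocubical C)
    (u : precubical_map X Y) : precubical_map (pc_image F X) (pc_image F Y).
Proof.
by exists (fun n => fmap F (u n)) => n e i lin; rewrite -!fmapM pcmapE.
Defined.

Definition pc_image_nat (F G : functor C D) (t : nattrans F G)
    (X : pseudocubical C) : precubical_map (pc_image F X) (pc_image G X).
Proof. by exists (fun n => t (X n)) => n e i _; rewrite ncompE. Defined.

End PcImage.

Section NormalizedComplex.
Local Open Scope ring_scope.
Variable B : abelian.
Implicit Types X Y : pseudocubical B.

Definition normal_data X n : {k : B & hom k (X n)} :=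
  match n with
  | 0 => existT (fun k => hom k (X 0)) (X 0) (idm (X 0))
  | m.+1 => ker_cap (pcface X m true) m.+1
  end.
Definition normal X n : B := projT1 (normal_data X n).
Definition normal_inc X n : hom (normal X n) (X n) := projT2 (normal_data X n).

Arguments normal : simpl never.
Arguments normal_inc : simpl never.

(* x factors through the subobject N(X)_n of X_n *)
Definition is_normal X n a (x : hom a (X n)) : Prop :=
  match n return hom a (X n) -> Prop with
  | 0 => fun=> True
  | m.+1 => fun x => forall i, (0 < i <= m.+1)%N -> pcface X m true i ∘ x = 0
  end x.

Lemma normal_inc_normal X n : is_normal (normal_inc X n).
Proof. by case: n => [|n] //= i; apply: (@ker_cap0 B _ _ (pcface X n true)). Qed.

Lemma normal_inc0 X n i : (0 < i <= n.+1)%N ->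
  pcface X n true i ∘ normal_inc X n.+1 = 0.
Proof. exact: (@normal_inc_normal X n.+1). Qed.

Lemma normal_inc_mono X n : mono (normal_inc X n).
Proof.
case: n => [|n]; last exact: (@ker_cap_mono B _ _ (pcface X n true) n.+1).
by move=> x u v; rewrite !comp1m.
Qed.

Lemma normal_lift_exists X n a (x : hom a (X n)) : is_normal x ->
  exists h, normal_inc X n ∘ h = x.
Proof.
case: n x => [|n] x /=; first by exists x; rewrite comp1m.
by move=> /ker_cap_lift[h [hE _]]; exists h.
Qed.

Lemma is_normal_comp X n a b (x : hom a (X n)) (y : hom b a) :
  is_normal x -> is_normal (x ∘ y).
Proof. by case: n x => [|n] x //= xN i lin; rewrite compA xN ?comp0m. Qed.

Definition normal_lift X n a (x : hom a (X n)) (xN : is_normal x) :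
    hom a (normal X n) := sval (cid (normal_lift_exists xN)).

Lemma normal_liftE X n a (x : hom a (X n)) (xN : is_normal x) :
  normal_inc X n ∘ normal_lift xN = x.
Proof. exact: (svalP (cid (normal_lift_exists xN))). Qed.

Definition pc_sum X n : hom (X n.+1) (X n) :=
  \sum_(1 <= i < n.+2) pcface X n false i *~ (-1) ^+ i.+1.

Lemma pc_sumE X n :
  pc_sum X n = \sum_(i < n.+1) pcface X n false i.+1 *~ (-1) ^+ i.
Proof.
rewrite /pc_sum big_add1 /= big_mkord; apply: eq_bigr => i _.
by rewrite !signz /= negbK.
Qed.

Lemma pc_sum_sq X n : pc_sum X n ∘ pc_sum X n.+1 = 0.
Proof.
rewrite !pc_sumE.
apply: (alt_sum_sq (d := fun i => pcface X n false i.+1)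
                   (e := fun i => pcface X n.+1 false i.+1)) => i j lij.
by rewrite pcface_face /=; [case: j lij|lia].
Qed.

Lemma pc_sum_normal X n : is_normal (pc_sum X n ∘ normal_inc X n.+1).
Proof.
case: n => [//|n] /= i lin.
rewrite pc_sumE comp_suml comp_sumr big1 // => j _.
have lj := ltn_ord j.
rewrite compsl compsr signz compA.
have -> : pcface X n true i ∘ pcface X n.+1 false j.+1 ∘ normal_inc X n.+2 = 0.
  have [ij|ji] := leqP i j.
    rewrite pcface_face; last lia.
    by rewrite -compA normal_inc0 ?compm0 //; lia.
  rewrite -[i]/(i.+1.-1) -pcface_face; last lia.
  by rewrite -compA normal_inc0 ?compm0 //; lia.
by rewrite oppr0 if_same.
Qed.

Definition normal_diff X n : hom (normal X n.+1) (normal X n) :=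
  normal_lift (@pc_sum_normal X n).

Lemma normal_diffE X n :
  normal_inc X n ∘ normal_diff X n = pc_sum X n ∘ normal_inc X n.+1.
Proof. exact: normal_liftE. Qed.

Lemma normal_diff_sq X n : normal_diff X n ∘ normal_diff X n.+1 = 0.
Proof.
apply: normal_inc_mono; rewrite compA normal_diffE -compA normal_diffE.
by rewrite compA pc_sum_sq comp0m compm0.
Qed.

Definition normal_complex X : chain_complex B := ChainComplex (@normal_diff_sq X).

Lemma normal_map_normal X Y (u : precubical_map X Y) n :
  is_normal (u n ∘ normal_inc X n).
Proof.
case: n => [//|n] /= i lin.
by rewrite compA -pcmapE // -compA normal_inc0 ?compm0.
Qed.

Definition normal_map X Y (u : precubical_map X Y) n :
    hom (normal X n) (normal Y n) :=
  normal_lift (normal_map_normal u n).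

Lemma normal_mapE X Y (u : precubical_map X Y) n :
  normal_inc Y n ∘ normal_map u n = u n ∘ normal_inc X n.
Proof. exact: normal_liftE. Qed.

Lemma pcmap_sum X Y (u : precubical_map X Y) n :
  u n ∘ pc_sum X n = pc_sum Y n ∘ u n.+1.
Proof.
rewrite !pc_sumE comp_sumr comp_suml; apply: eq_bigr => i _.
by rewrite compsr compsl pcmapE; last exact: (ltn_ord i).
Qed.

Lemma normal_map_diff X Y (u : precubical_map X Y) n :
  normal_map u n ∘ normal_diff X n = normal_diff Y n ∘ normal_map u n.+1.
Proof.
apply: normal_inc_mono; rewrite [LHS]compA normal_mapE -compA normal_diffE.
rewrite [RHS]compA normal_diffE -[RHS]compA normal_mapE [LHS]compA [RHS]compA.
by rewrite pcmap_sum.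
Qed.

Definition normal_complex_map X Y (u : precubical_map X Y) :
    chain_map (normal_complex X) (normal_complex Y) :=
  @ChainMap _ (normal_complex X) (normal_complex Y) (normal_map u)
    (normal_map_diff u).

Lemma pc_htpy_homology X Y (f g : precubical_map X Y)
    (h : forall n, hom (X n) (Y n.+1)) :
  (forall n, pcface Y n false 1 ∘ h n = f n) ->
  (forall n, pcface Y n true 1 ∘ h n = g n) ->
  (forall n e i, (1 < i <= n.+2)%N ->
     pcface Y n.+1 e i ∘ h n.+1 = h n ∘ pcface X n e i.-1) ->
  forall n, homology_map (normal_complex_map f) n =
            homology_map (normal_complex_map g) n.
Proof.
move=> hf hg hh n.
pose s m := h m - pcdegen Y m 1 ∘ g m.
have s0 m : pcface Y m false 1 ∘ s m = f m - g m.
  by rewrite compBr hf compA pcface_degen_eq // comp1m.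
have s1 m : pcface Y m true 1 ∘ s m = 0.
  by rewrite compBr hg compA pcface_degen_eq // comp1m subrr.
have ss m e i : (1 < i <= m.+2)%N ->
    pcface Y m.+1 e i ∘ s m.+1 = s m ∘ pcface X m e i.-1.
  move=> li; rewrite compBr hh // compBl compA pcface_degen_gt; last lia.
  by rewrite -!compA pcmapE //; lia.
have sN m : is_normal (s m ∘ normal_inc X m).
  move=> /= i lim; rewrite compA; have [->|i1] := eqVneq i 1%N.
    by rewrite s1 comp0m.
  case: m lim => [|m] lim; first lia.
  by rewrite ss -?compA ?normal_inc0 ?compm0 //; lia.
pose t m : hom (normal X m) (normal Y m.+1) := normal_lift (sN m).
have tE m : normal_inc Y m.+1 ∘ t m = s m ∘ normal_inc X m by exact: normal_liftE.
have sE m : f m.+1 - g m.+1 = pc_sum Y m.+1 ∘ s m.+1 + s m ∘ pc_sum X m.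
  rewrite !pc_sumE big_ord_recl compDl expr0 mulr1z s0 -[RHS]addrA -[LHS]addr0.
  congr (_ + _); rewrite comp_suml comp_sumr -big_split big1 // => i _.
  rewrite compsl compsr ss; last by have := ltn_ord i; rewrite /= /bump; lia.
  by rewrite !signz /=; case: odd; rewrite ?addNr ?subrr.
case: n => [|n].
  apply: (@homology_map_htpy B (normal_complex X) (normal_complex Y)
    (normal_complex_map f) (normal_complex_map g) 0 (t 0%N) 0).
  rewrite comp0m addr0; apply: normal_inc_mono.
  rewrite compBr !normal_mapE [RHS]compA normal_diffE -[RHS]compA tE.
  by rewrite pc_sumE big_ord1 expr0 mulr1z compA s0 compBl.
apply: (@homology_map_htpy B (normal_complex X) (normal_complex Y)
  (normal_complex_map f) (normal_complex_map g) n.+1 (t n.+1) (t n)).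
apply: normal_inc_mono; rewrite compBr !normal_mapE compDr.
rewrite [X in _ = X + _]compA normal_diffE -[X in _ = X + _]compA tE.
rewrite [X in _ = _ + X]compA tE -[X in _ = _ + X]compA normal_diffE.
by rewrite [X in _ = X + _]compA [X in _ = _ + X]compA -compBl -compDl sE.
Qed.

End NormalizedComplex.

Section PcComparison.
Variables (C : category) (P : C -> Prop) (c d : C).
Variables (X : pc_resolution P c) (Y : pc_resolution P d).

Lemma pc_lift_exists (f : hom c d) : exists u : precubical_map X Y, pc_lifts f u.
Proof.
pose R n (u : hom (X n) (Y n)) (v : hom (X n.+1) (Y n.+1)) :=
  forall e i, 0 < i <= n.+1 -> u ∘ pcface X n e i = pcface Y n e i ∘ v.
have [ex0 _ _] := pcr_exact Y (pcr_proj X 0).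
have [u0 u0E] := ex0 (f ∘ pcr_aug X).
have [_ ex1 _] := pcr_exact Y (pcr_proj X 1).
have [|u1 [u1f u1t]] := ex1 (u0 ∘ pcface X 0 false 1) (u0 ∘ pcface X 0 true 1).
  by rewrite !compA u0E -!compA pcr_augE.
have step n u v : R n u v -> exists w, R n.+1 v w.
  move=> uv; have [_ _ exn] := pcr_exact Y (pcr_proj X n.+2).
  have [|w wE] := exn n (fun e i => v ∘ pcface X n.+1 e i).
    move=> a e i j lij; rewrite !compA -!uv; try lia.
    by rewrite -!compA pcface_face.
  by exists w => e i li; rewrite wE.
have [|t [t0 tE]] := dependent_tower step (x0 := u0) (x1 := u1).
  by move=> e i li; have -> : i = 1 by [lia]; case: e.
by exists (PrecubicalMap tE); rewrite /pc_lifts /= t0.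
Qed.

Lemma pc_lift_unique (f : hom c d) (u v : precubical_map X Y) (B : abelian)
    (F : functor C B) : pc_lifts f u -> pc_lifts f v -> forall n,
  homology_map (normal_complex_map (pc_image_map F u)) n =
  homology_map (normal_complex_map (pc_image_map F v)) n.
Proof.
move=> uf vf.
pose Q n (h : hom (X n) (Y n.+1)) :=
  pcface Y n false 1 ∘ h = u n /\ pcface Y n true 1 ∘ h = v n.
pose R n (h : hom (X n) (Y n.+1)) (l : hom (X n.+1) (Y n.+2)) :=
  [/\ Q n h, Q n.+1 l & forall e i, 1 < i <= n.+2 ->
      pcface Y n.+1 e i ∘ l = h ∘ pcface X n e i.-1].
have step n h : Q n h ->
    (forall a e i j, [&& 1 < i, i < j & j <= n.+2] ->
       pcface Y n a i ∘ (h ∘ pcface X n e j.-1) =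
       pcface Y n e j.-1 ∘ (h ∘ pcface X n a i.-1)) -> exists l, R n h l.
  move=> [hu hv] hE; have [_ _ exn] := pcr_exact Y (pcr_proj X n.+1).
  have [|l lE] := exn n (fun e i => if i == 1 then (if e then v n.+1 else u n.+1)
                                    else h ∘ pcface X n e i.-1).
    move=> a e i j lij; rewrite [j == 1]gtn_eqF; last lia.
    have [->|i1] := eqVneq i 1; last by apply: hE; lia.
    by rewrite compA; case: a => /=; rewrite ?hu ?hv pcmapE //; lia.
  exists l; split => //.
    by split; rewrite lE.
  by move=> e i li; rewrite lE ?gtn_eqF //; lia.
have [h0 Q0] : exists h0, Q 0 h0.
  have [_ ex1 _] := pcr_exact Y (pcr_proj X 0).
  by have [|h0 h0E] := ex1 (u 0) (v 0); [rewrite uf vf|exists h0].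
have [h1 R0] : exists h1, R 0 h0 h1.
  by apply: step => // a e i j; lia.
have stepR m h l : R m h l -> exists w, R m.+1 l w.
  move=> [_ Ql lE]; apply: step => // a e i j lij.
  rewrite !compA !lE; try lia.
  rewrite -!compA; congr (_ ∘ _).
  by rewrite pcface_face //; lia.
have [h [_ hE]] := dependent_tower stepR R0.
apply: (@pc_htpy_homology B (pc_image F X) (pc_image F Y) (pc_image_map F u)
  (pc_image_map F v) (fun m => fmap F (h m))) => /= m.
- by have [[<- _] _ _] := hE m; rewrite /= fmapM.
- by have [[_ <-] _ _] := hE m; rewrite /= fmapM.
- by have [_ _ hmE] := hE m; move=> e i li; rewrite /= -!fmapM hmE.
Qed.

End PcComparison.

Section CubicalDerived.
Variables (C : category) (P : C -> Prop) (X : forall c, pc_resolution P c).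
Variables (B : abelian) (n : nat).

Definition pc_lift (c d : C) (f : hom c d) : precubical_map (X c) (X d) :=
  sval (cid (pc_lift_exists (X c) (X d) f)).

Lemma pc_liftP (c d : C) (f : hom c d) : pc_lifts f (pc_lift f).
Proof. exact: svalP. Qed.

Definition cubical_derived_obj (F : functor C B) (c : C) : B :=
  homology (normal_complex (pc_image F (X c))) n.

Definition cubical_derived_map (F : functor C B) (c d : C) (f : hom c d) :
    hom (cubical_derived_obj F c) (cubical_derived_obj F d) :=
  homology_map (normal_complex_map (pc_image_map F (pc_lift f))) n.

Lemma cubical_derived_mapE (F : functor C B) (c d : C) (f : hom c d)
    (u : precubical_map (X c) (X d)) : pc_lifts f u ->
  cubical_derived_map F f =
  homology_map (normal_complex_map (pc_image_map F u)) n.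
Proof. by move=> uf; apply: (pc_lift_unique F (pc_liftP f) uf). Qed.

Lemma cubical_homology_comp (U V W : pseudocubical B) (g : precubical_map V W)
    (f : precubical_map U V) (h : precubical_map U W) :
  (forall m, h m = g m ∘ f m) ->
  homology_map (normal_complex_map h) n =
  homology_map (normal_complex_map g) n ∘ homology_map (normal_complex_map f) n.
Proof.
move=> hE; apply: homology_map_comp; apply: normal_inc_mono.
by rewrite normal_mapE [RHS]compA normal_mapE -[RHS]compA normal_mapE compA hE.
Qed.

Lemma cubical_derived_map1 (F : functor C B) (c : C) :
  cubical_derived_map F (idm c) = idm (cubical_derived_obj F c).
Proof.
rewrite (@cubical_derived_mapE _ _ _ _ (pc_id (X c))); last first.
  by rewrite /pc_lifts /= compm1 comp1m.
apply: homology_map_id; apply: normal_inc_mono.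
by rewrite normal_mapE /= fmap1 comp1m compm1.
Qed.

Lemma cubical_derived_mapM (F : functor C B) (a b c : C) (g : hom b c)
    (f : hom a b) :
  cubical_derived_map F (g ∘ f) =
  cubical_derived_map F g ∘ cubical_derived_map F f.
Proof.
rewrite (@cubical_derived_mapE _ _ _ _ (pc_comp (pc_lift g) (pc_lift f))).
  by apply: cubical_homology_comp => m; rewrite /= fmapM.
by rewrite /pc_lifts /= compA pc_liftP -!compA pc_liftP.
Qed.

Definition cubical_derived (F : functor C B) : functor C B :=
  Functor (cubical_derived_map1 F) (cubical_derived_mapM F).

Lemma cubical_derived_nat_subproof (F G : functor C B) (t : nattrans F G)
    (c d : C) (f : hom c d) :
  homology_map (normal_complex_map (pc_image_nat t (X d))) n ∘
    fmap (cubical_derived F) f =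
  fmap (cubical_derived G) f ∘
    homology_map (normal_complex_map (pc_image_nat t (X c))) n.
Proof.
pose u := pc_comp (pc_image_nat t (X d)) (pc_image_map F (pc_lift f)).
rewrite -(@cubical_homology_comp _ _ _ _ _ u) //.
by apply: cubical_homology_comp => m; rewrite /= ncompE.
Qed.

Definition cubical_derived_nat (F G : functor C B) (t : nattrans F G) :
    nattrans (cubical_derived F) (cubical_derived G) :=
  @NatTrans _ _ (cubical_derived F) (cubical_derived G)
    (fun c => homology_map (normal_complex_map (pc_image_nat t (X c))) n)
    (cubical_derived_nat_subproof t).

End CubicalDerived.

(* Main.v *)
(* Pass to the additive category Z[C] with the objects of C, whose morphisms are
   the formal integer combinations of morphisms of C.  Every functor F from C to
   B extends additively to Z[C].  A simplicial resolution S gives the complex Z[S]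
   with the alternating sum of the faces, and a cubical resolution X gives the
   image in Z[X] of the idempotents (1 - s_1 d_1^1) ... (1 - s_n d_n^1), which
   exists in the idempotent completion of Z[C]; applying F yields K(F S) and
   N(F X).  On each set Hom(q, -) with q in P the filling conditions provide a
   contraction of S and of X, which need not be natural in q, so both complexes are
   resolutions by objects that lift against them.  The usual comparison theorem
   then gives chain homotopy equivalences between them that do not depend on F and
   are, up to homotopy, natural in the resolved object. *)

From HB Require Import structures.
From mathcomp Require Import all_boot all_order all_algebra.
From mathcomp Require Import zify boolp.
From mathcomp.multinomials Require Import freeg.
Require Import Defs.

Set Implicit Arguments.
Unset Strict Implicit.
Unset Printing Implicit Defensive.

Import GRing.Theory.
Local Open Scope ring_scope.
Local Open Scope cat_scope.

(** * The additive category generated by a category *)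

Section FreeAbelian.

(** [freeg] needs a choice structure on its generators; [{classic T}] puts one on any type, so
    arbitrary Hom types can serve as bases. *)
Definition free_ab (T : Type) : zmodType := {freeg {classic T} / int}.

Definition free_gen (T : Type) (t : T) : free_ab T := << (t : {classic T}) >>.

Definition free_lift (T : Type) (V : zmodType) (f : T -> V) (x : free_ab T) : V :=
  fglift (f : {classic T} -> zmodule V) x.

Lemma free_liftE (T : Type) (V : zmodType) (f : T -> V) (t : T) :
  free_lift f (free_gen t) = f t.
Proof. by rewrite /free_lift liftU; apply: mulr1z. Qed.

Lemma free_liftB (T : Type) (V : zmodType) (f : T -> V) (x y : free_ab T) :
  free_lift f (x - y) = free_lift f x - free_lift f y.
Proof. exact: (lift_is_additive (f : {classic T} -> zmodule V) x y). Qed.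

HB.instance Definition _ (T : Type) (V : zmodType) (f : T -> V) :=
  GRing.isZmodMorphism.Build (free_ab T) V (free_lift f) (free_liftB f).

(** [Q] contains 0 and is closed under differences, so it cuts out a subgroup, and the generators
    span the whole group. *)
Lemma free_ab_ind (T : Type) (Q : free_ab T -> Prop) :
  Q 0 -> (forall x y, Q x -> Q y -> Q (x - y)) -> (forall t, Q (free_gen t)) ->
  forall x, Q x.
Proof.
move=> Q0 QB Qg x.
have QN y : Q y -> Q (- y) by move=> /(QB 0 _ Q0); rewrite sub0r.
have QD y z : Q y -> Q z -> Q (y + z).
  by move=> Qy /QN/(QB y _ Qy); rewrite opprK.
rewrite -[x]freeg_sumE; apply: big_ind => // z _.
have -> : << coeff z x *g z >> = (free_gen (z : T)) *~ coeff z x.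
  by rewrite /free_gen freegU_mulz intz.
case: (coeff z x) => k; rewrite ?NegzE ?mulrNz -?pmulrn.
  by elim: k => [|k IH]; rewrite ?mulr0n ?mulrS //; apply: QD.
(* [Negz k] stands for -(k+1), so this induction starts from one copy of the generator. *)
by apply: QN; elim: k => [|k IH]; rewrite ?mulr1n // mulrS; apply: QD.
Qed.

End FreeAbelian.

Section Linearization.
Variable C : category.

Definition lin_hom (a b : C) : zmodType := free_ab (hom a b).

(** Bilinear extension of composition, expanded first in [g]: additivity in [g] is immediate, while
    additivity in [f] takes an induction on [g]. *)
Definition lin_comp (a b c : C) (g : lin_hom b c) (f : lin_hom a b) : lin_hom a c :=
  free_lift (fun g' => free_lift (fun f' => free_gen (g' ∘ f')) f) g.

Lemma lin_compBl (a b c : C) (g g' : lin_hom b c) (f : lin_hom a b) :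
  lin_comp (g - g') f = lin_comp g f - lin_comp g' f.
Proof. exact: raddfB. Qed.

Lemma lin_comp0m (a b c : C) (f : lin_hom a b) : lin_comp 0 f = 0 :> lin_hom a c.
Proof. exact: raddf0. Qed.

Lemma lin_comp_genl (a b c : C) (g : hom b c) (f : lin_hom a b) :
  lin_comp (free_gen g) f = free_lift (fun f' => free_gen (g ∘ f')) f.
Proof. exact: free_liftE. Qed.

Lemma lin_compBr (a b c : C) (g : lin_hom b c) (f f' : lin_hom a b) :
  lin_comp g (f - f') = lin_comp g f - lin_comp g f'.
Proof.
elim/free_ab_ind: g => [|g g' IH IH'|g].
- by rewrite !lin_comp0m subr0.
- by rewrite !lin_compBl IH IH' !opprD addrACA.
- by rewrite !lin_comp_genl raddfB.
Qed.

Lemma lin_compm0 (a b c : C) (g : lin_hom b c) : lin_comp g 0 = 0 :> lin_hom a c.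
Proof. by rewrite -(subrr 0) lin_compBr subrr. Qed.

Lemma lin_comp_gen (a b c : C) (g : hom b c) (f : hom a b) :
  lin_comp (free_gen g) (free_gen f) = free_gen (g ∘ f).
Proof. by rewrite lin_comp_genl free_liftE. Qed.

Lemma lin_comp1m (a b : C) (f : lin_hom a b) : lin_comp (free_gen (idm b)) f = f.
Proof.
elim/free_ab_ind: f => [|f f' IH IH'|f]; first exact: lin_compm0.
  by rewrite lin_compBr IH IH'.
by rewrite lin_comp_gen comp1m.
Qed.

Lemma lin_compm1 (a b : C) (f : lin_hom a b) : lin_comp f (free_gen (idm a)) = f.
Proof.
elim/free_ab_ind: f => [|f f' IH IH'|f]; first exact: lin_comp0m.
  by rewrite lin_compBl IH IH'.
by rewrite lin_comp_gen compm1.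
Qed.

Lemma lin_compA (a b c d : C) (h : lin_hom c d) (g : lin_hom b c) (f : lin_hom a b) :
  lin_comp h (lin_comp g f) = lin_comp (lin_comp h g) f.
Proof.
elim/free_ab_ind: h => [|h h' IH IH'|h]; first by rewrite !lin_comp0m.
  by rewrite !lin_compBl IH IH'.
elim/free_ab_ind: g => [|g g' IH IH'|g]; first by rewrite lin_comp0m !lin_compm0 lin_comp0m.
  by rewrite lin_compBr !lin_compBl lin_compBr IH IH'.
elim/free_ab_ind: f => [|f f' IH IH'|f]; first by rewrite !lin_compm0.
  by rewrite !lin_compBr IH IH'.
by rewrite !lin_comp_gen compA.
Qed.

Definition lin_category : category :=
  Category lin_comp1m lin_compm1 lin_compA.

Definition lin_zcategory : zcategory :=
  @ZCategory lin_category (fun a b => GRing.Zmodule.class (lin_hom a b)).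

Lemma lin_compDl (a b c : lin_zcategory) (g g' : hom b c) (f : hom a b) :
  (g + g') ∘ f = g ∘ f + g' ∘ f.
Proof. exact: raddfD. Qed.

Lemma lin_compDr (a b c : lin_zcategory) (g : hom b c) (f f' : hom a b) :
  g ∘ (f + f') = g ∘ f + g ∘ f'.
Proof.
have N (x : hom a b) : g ∘ (- x) = - (g ∘ x).
  by rewrite -sub0r [LHS]lin_compBr lin_compm0 sub0r.
by rewrite -[f']opprK [LHS]lin_compBr [in RHS]N.
Qed.

Definition lin : preadditive := Preadditive lin_compDl lin_compDr.

Definition lin_gen (a b : C) (f : hom a b) : hom (a : lin) (b : lin) := free_gen f.

Lemma lin_genM (a b c : C) (g : hom b c) (f : hom a b) :
  lin_gen (g ∘ f) = lin_gen g ∘ lin_gen f.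
Proof. by rewrite [RHS]lin_comp_gen. Qed.

Lemma lin_gen1 (a : C) : lin_gen (idm a) = idm (a : lin).
Proof. by []. Qed.

Lemma lin_ind (a b : C) (Q : hom (a : lin) (b : lin) -> Prop) :
  Q 0 -> (forall x y, Q x -> Q y -> Q (x - y)) -> (forall f, Q (lin_gen f)) ->
  forall x, Q x.
Proof. exact: free_ab_ind. Qed.

Definition lin_incl : functor C lin := @Functor C lin id lin_gen lin_gen1 lin_genM.

(** Here [s] may be any function of Hom sets, not only composition with a morphism. In this way
    contractions chosen by filling act on formal sums. *)
Definition lin_ext (a b a' b' : C) (s : hom a b -> hom a' b')
    (x : hom (a : lin) (b : lin)) : hom (a' : lin) (b' : lin) :=
  free_lift (fun f => lin_gen (s f)) x.

Lemma lin_ext_gen (a b a' b' : C) (s : hom a b -> hom a' b') f :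
  lin_ext s (lin_gen f) = lin_gen (s f).
Proof. exact: free_liftE. Qed.

Lemma lin_extB (a b a' b' : C) (s : hom a b -> hom a' b') x y :
  lin_ext s (x - y) = lin_ext s x - lin_ext s y.
Proof. exact: free_liftB. Qed.

HB.instance Definition _ (a b a' b' : C) (s : hom a b -> hom a' b') :=
  GRing.isZmodMorphism.Build _ _ (lin_ext s) (lin_extB s).

Lemma lin_ext0 (a b a' b' : C) (s : hom a b -> hom a' b') : lin_ext s 0 = 0.
Proof. exact: raddf0. Qed.

Lemma lin_ext_sum (a b a' b' : C) (s : hom a b -> hom a' b') (I : Type) (r : seq I)
    (Q : pred I) (x : I -> hom (a : lin) (b : lin)) :
  lin_ext s (\sum_(i <- r | Q i) x i) = \sum_(i <- r | Q i) lin_ext s (x i).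
Proof. exact: raddf_sum. Qed.

Lemma lin_extMz (a b a' b' : C) (s : hom a b -> hom a' b') x k :
  lin_ext s (x *~ k) = lin_ext s x *~ k.
Proof. exact: raddfMz. Qed.

Lemma lin_ext_id (a b : C) (s : hom a b -> hom a b) x :
  (forall f, s f = f) -> lin_ext s x = x.
Proof.
move=> sE; move: x; apply: lin_ind => [|x y IH IH'|f]; first exact: lin_ext0.
  by rewrite lin_extB IH IH'.
by rewrite lin_ext_gen sE.
Qed.

(** Both sides are additive in [x], so a face relation satisfied by a contraction on Hom sets passes
    to formal sums. *)
Lemma lin_ext_comp (a b a' b' d e : C) (s : hom a b -> hom a' d) (g : hom d b')
    (s' : hom a e -> hom a' b') (g' : hom b e) x :
  (forall f, g ∘ s f = s' (g' ∘ f)) ->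
  lin_gen g ∘ lin_ext s x = lin_ext s' (lin_gen g' ∘ x).
Proof.
move=> E; move: x; apply: lin_ind => [|x y IH IH'|f].
- by rewrite lin_ext0 !(@compm0 lin) lin_ext0.
- by rewrite lin_extB !(@compBr lin) lin_extB IH IH'.
- by rewrite lin_ext_gen -!lin_genM lin_ext_gen E.
Qed.

Lemma lin_comp_ext (a b d : C) (s : hom a b -> hom a d) (g : hom d b) x :
  (forall f, g ∘ s f = f) -> lin_gen g ∘ lin_ext s x = x.
Proof.
move=> E; rewrite (@lin_ext_comp _ _ _ _ _ _ _ _ id (idm b)) => [|f].
  by rewrite lin_gen1 comp1m lin_ext_id.
by rewrite E comp1m.
Qed.

Variable B : preadditive.

Section Eval.
Variable F : functor C B.

(** The additive extension of an arbitrary functor [F] to [lin C]; [lin_evalM] and [lin_eval1] make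
    it functorial. *)
Definition lin_eval (a b : lin) (x : hom a b) : hom (F a) (F b) :=
  free_lift (fmap F (a := a) (b := b)) x.

Lemma lin_eval_gen (a b : C) (f : hom a b) : lin_eval (lin_gen f) = fmap F f.
Proof. exact: free_liftE. Qed.

Lemma lin_evalB (a b : lin) (x y : hom a b) :
  lin_eval (x - y) = lin_eval x - lin_eval y.
Proof. exact: free_liftB. Qed.

HB.instance Definition _ (a b : lin) :=
  GRing.isZmodMorphism.Build _ _ (@lin_eval a b) (@lin_evalB a b).

Lemma lin_evalD (a b : lin) (x y : hom a b) :
  lin_eval (x + y) = lin_eval x + lin_eval y.
Proof. exact: raddfD. Qed.

Lemma lin_eval_sum (a b : lin) (I : Type) (r : seq I) (Q : pred I) (x : I -> hom a b) :
  lin_eval (\sum_(i <- r | Q i) x i) = \sum_(i <- r | Q i) lin_eval (x i).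
Proof. exact: raddf_sum. Qed.

Lemma lin_evalMz (a b : lin) (x : hom a b) k : lin_eval (x *~ k) = lin_eval x *~ k.
Proof. exact: raddfMz. Qed.

Lemma lin_evalM (a b c : lin) (g : hom b c) (f : hom a b) :
  lin_eval (g ∘ f) = lin_eval g ∘ lin_eval f.
Proof.
elim/lin_ind: g => [|g g' IH IH'|g]; first by rewrite comp0m !raddf0 comp0m.
  by rewrite compBl !lin_evalB IH IH' compBl.
elim/lin_ind: f => [|f f' IH IH'|f]; first by rewrite compm0 !raddf0 compm0.
  by rewrite compBr !lin_evalB IH IH' compBr.
by rewrite -lin_genM !lin_eval_gen fmapM.
Qed.

Lemma lin_eval1 (a : lin) : lin_eval (idm a) = idm (F a).
Proof. by rewrite -lin_gen1 lin_eval_gen fmap1. Qed.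

End Eval.

Lemma lin_eval_nat (F G : functor C B) (t : nattrans F G) (a b : lin) (x : hom a b) :
  t b ∘ lin_eval F x = lin_eval G x ∘ t a.
Proof.
elim/lin_ind: x => [|x y IH IH'|f]; first by rewrite !raddf0 compm0 comp0m.
  by rewrite !lin_evalB compBr compBl IH IH'.
by rewrite !lin_eval_gen ncompE.
Qed.

End Linearization.

(** * Comparison of complexes with idempotents *)

(* A chain complex in the idempotent completion of A: the object in degree n is
   the image of the idempotent [kidem n]. *)
Record kcomplex (A : preadditive) := KComplex {
  kchain :> chain_complex A;
  kidem : forall n, hom (kchain n) (kchain n);
  kidem_idem : forall n, kidem n ∘ kidem n = kidem n;
  kdiff_idem : forall n, diff kchain n ∘ kidem n.+1 = diff kchain n;
  kidem_diff : forall n, kidem n ∘ diff kchain n = diff kchain n }.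

Section KComplexes.
Variable A : preadditive.
Implicit Types K L M : kcomplex A.

(* Absorbing the source idempotent is not required: only the restriction of a map
   to the image of that idempotent matters. *)
Record kmap K L := KMap {
  kmap_chain :> chain_map K L;
  kmapN : forall n, kidem L n ∘ kmap_chain n = kmap_chain n }.

Definition chain_comp (K L M : chain_complex A) (v : chain_map L M) (u : chain_map K L) :
  chain_map K M.
Proof.
by exists (fun n => v n ∘ u n) => n; rewrite -compA cmapE !compA cmapE.
Defined.

Definition kcomp K L M (v : kmap L M) (u : kmap K L) : kmap K M.
Proof. by exists (chain_comp v u) => n; rewrite /= compA kmapN. Defined.

Lemma kid_subproof K n : kidem K n ∘ diff K n = diff K n ∘ kidem K n.+1.
Proof. by rewrite kidem_diff kdiff_idem. Qed.

(** The identity on the image of an idempotent is the idempotent itself. *)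
Definition kid K : kmap K K := @KMap K K (ChainMap (@kid_subproof K)) (@kidem_idem A K).

(* Complexes are augmented: degree 0 holds the resolved object, and the
   differential leaving degree 1 is the augmentation. *)
Definition kexact (P : A -> Prop) K : Prop :=
  forall q, P q -> forall n (x : hom q (K n)),
    kidem K n ∘ x = x -> diff_out K n ∘ x = 0 ->
    exists2 y : hom q (K n.+1), kidem K n.+1 ∘ y = y & diff K n ∘ y = x.

Variables (P : A -> Prop) (K L : kcomplex A).
Hypotheses (KP : forall n, P (K n.+1)) (L_exact : kexact P L).

(** Each component is a preimage of a cycle of [L], found by exactness inside the image of the
    idempotent. Objects in [P] start in degree 1, as degree 0 holds the resolved object. *)
Lemma kmap_exists (f : hom (K 0) (L 0)) : kidem L 0 ∘ f = f ->
  exists u : kmap K L, u 0%N = f.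
Proof.
move=> fN.
pose R n (u : hom (K n) (L n)) (v : hom (K n.+1) (L n.+1)) :=
  [/\ kidem L n ∘ u = u, kidem L n.+1 ∘ v = v & u ∘ diff K n = diff L n ∘ v].
have fill n (u : hom (K n) (L n)) : kidem L n ∘ u = u ->
    diff_out L n ∘ (u ∘ diff K n) = 0 -> exists v, R n u v.
  move=> uN du; have [|v vN vE] := L_exact (KP n) _ du.
    by rewrite compA uN.
  by exists v.
have [v0 R0] : exists v, R 0%N f v by apply: fill; rewrite //= comp0m.
have step n u v : R n u v -> exists w, R n.+1 v w.
  move=> [uN vN uv]; apply: fill => //=.
  by rewrite compA -uv -compA diff_sq compm0.
have [t [t0 tR]] := dependent_tower step R0.
have tE n : t n ∘ diff K n = diff L n ∘ t n.+1 by have [] := tR n.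
have tN n : kidem L n ∘ t n = t n by have [] := tR n.
by exists (@KMap K L (ChainMap tE) tN).
Qed.

(** [u - v] vanishes in degree 0, so a homotopy can start from 0 and be continued by exactness of
    [L]. The value 0 is recorded because realizations drop degree 0. *)
Lemma kmap_htpy (u v : kmap K L) : u 0%N = v 0%N ->
  exists h : forall n, hom (K n) (L n.+1), h 0%N = 0 /\ forall n,
    (u n.+1 - v n.+1) ∘ kidem K n.+1 = diff L n.+1 ∘ h n.+1 + h n ∘ diff K n.
Proof.
move=> uv0.
pose w n := u n - v n.
have wE n : diff L n ∘ w n.+1 = w n ∘ diff K n.
  by rewrite compBr compBl !cmapE.
have wN n : kidem L n ∘ w n = w n by rewrite compBr !kmapN.
pose Q n (h : hom (K n) (L n.+1)) := kidem L n.+1 ∘ h = h.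
pose R n (h : hom (K n) (L n.+1)) (h' : hom (K n.+1) (L n.+2)) :=
  Q n h /\ Q n.+1 h' /\
  diff L n.+1 ∘ h' = w n.+1 ∘ kidem K n.+1 - h ∘ diff K n.
have fill n h : Q n h -> diff L n ∘ h ∘ diff K n = w n ∘ diff K n ->
    exists h', R n h h'.
  move=> hN hE; have [||y yN yE] := L_exact (KP n)
      (x := w n.+1 ∘ kidem K n.+1 - h ∘ diff K n).
  - by rewrite compBr !compA wN hN.
  - rewrite /= compBr !compA wE hE.
    by rewrite -compA kdiff_idem subrr.
  - by exists y.
have [h1 R0] : exists h1, R 0%N 0 h1.
  apply: fill; first exact: compm0.
  by rewrite compm0 comp0m /w uv0 subrr comp0m.
have step n h h' : R n h h' -> exists h'', R n.+1 h' h''.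
  move=> [_ [h'N hE]]; apply: fill => //.
  rewrite hE compBl -!compA diff_sq compm0 subr0.
  by rewrite kidem_diff.
have [h [h0 hR]] := dependent_tower step R0.
exists h; split => // n; have [_ [_ ->]] := hR n.
by rewrite subrK.
Qed.

End KComplexes.

(* M is the complex obtained from K by applying F, splitting the idempotents, and
   forgetting the augmentation. *)
Record realization (C : category) (B : preadditive) (F : functor C B)
    (K : kcomplex (lin C)) (M : chain_complex B) := Realization {
  rinc : forall n, hom (M n) (F (K n.+1));
  rret : forall n, hom (F (K n.+1)) (M n);
  rretK : forall n, rret n ∘ rinc n = idm (M n);
  rincK : forall n, rinc n ∘ rret n = lin_eval F (kidem K n.+1);
  rincE : forall n, rinc n ∘ diff M n = lin_eval F (diff K n.+1) ∘ rinc n.+1 }.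

(** * Chain maps and homotopies induced on realizations *)

Section Realization.
Variables (C : category) (P : C -> Prop) (B : abelian).
Implicit Types (F G : functor C B) (K L : kcomplex (lin C)).

Lemma rretE F K (M : chain_complex B) (r : realization F K M) n :
  rret r n ∘ lin_eval F (diff K n.+1) = diff M n ∘ rret r n.+1.
Proof.
rewrite -kdiff_idem lin_evalM -(rincK r n.+1).
rewrite [X in _ ∘ X]compA -rincE.
by rewrite !compA rretK comp1m.
Qed.

Section Map.
Variables (F : functor C B) (K L : kcomplex (lin C)) (M N : chain_complex B).
Variables (r : realization F K M) (s : realization F L N).

Definition rmap_comp (u : forall n, hom (K n) (L n)) n : hom (M n) (N n) :=
  rret s n ∘ lin_eval F (u n.+1) ∘ rinc r n.

Lemma rmap_subproof (u : kmap K L) n :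
  rmap_comp u n ∘ diff M n = diff N n ∘ rmap_comp u n.+1.
Proof.
rewrite /rmap_comp -!compA rincE [X in _ = X]compA -rretE -compA; congr (_ ∘ _).
by rewrite !compA -!lin_evalM cmapE.
Qed.

Definition rmap (u : kmap K L) : chain_map M N :=
  @ChainMap _ M N (rmap_comp u) (rmap_subproof u).

Lemma rinc_rmap (u : kmap K L) n :
  rinc s n ∘ rmap u n = lin_eval F (u n.+1) ∘ rinc r n.
Proof. by rewrite !compA rincK -lin_evalM kmapN. Qed.

(** [F] carries the homotopy of [kmap_htpy] to one between the realized maps; as it is 0 in the
    augmentation degree, no extra term survives in the lowest degree. *)
Lemma rmap_htpy (u v : kmap K L) n :
  (forall m, P (K m.+1)) -> kexact (A := lin C) P L -> u 0%N = v 0%N ->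
  homology_map (rmap u) n = homology_map (rmap v) n.
Proof.
move=> KP Lx uv; have [h [h0 hE]] := kmap_htpy KP Lx uv.
have iE m : (u m.+1 - v m.+1) ∘ kidem K m.+1 = diff L m.+1 ∘ h m.+1 + h m ∘ diff K m.
  exact: hE.
have rE m : rmap u m - rmap v m =
    rret s m ∘ lin_eval F (diff L m.+1 ∘ h m.+1 + h m ∘ diff K m) ∘ rinc r m.
  (* The source idempotent becomes [rinc ∘ rret] and is absorbed by [rinc r m]. *)
  rewrite -hE lin_evalM lin_evalB -(rincK r) -!compA rretK compm1.
  by rewrite compBl compBr !compA.
pose hr m := rret s m.+1 ∘ lin_eval F (h m.+1) ∘ rinc r m.
have dhE m : rret s m ∘ lin_eval F (diff L m.+1 ∘ h m.+1) ∘ rinc r m = diff N m ∘ hr m.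
  by rewrite lin_evalM !compA rretE.
case: n => [|m]; [apply: (homology_map_htpy (s := hr 0%N) (t := 0))
                 |apply: (homology_map_htpy (s := hr m.+1) (t := hr m))].
  by rewrite rE h0 comp0m addr0 dhE /= comp0m addr0.
rewrite rE lin_evalD compDr compDl dhE; congr (_ + _).
by rewrite lin_evalM -!compA rincE.
Qed.

End Map.
End Realization.

Section RealizationFunctor.
Variables (C : category) (B : abelian).
Implicit Types (F G : functor C B) (K L : kcomplex (lin C)).
Implicit Types (M N : chain_complex B).

Lemma rinc_mono F K M (r : realization F K M) n : mono (rinc r n).
Proof.
by move=> x u v /(congr1 (comp (rret r n))); rewrite !compA rretK !comp1m.
Qed.

Lemma rmap_id F K M (r : realization F K M) n : rmap r r (kid K) n = idm (M n).
Proof.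
apply: (@rinc_mono _ _ _ r); rewrite rinc_rmap.
change (kid K n.+1) with (kidem K n.+1).
by rewrite -(rincK r) -compA rretK.
Qed.

Lemma rmap_kcomp F K1 K2 K3 M1 M2 M3 (r1 : realization F K1 M1)
    (r2 : realization F K2 M2) (r3 : realization F K3 M3)
    (v : kmap K2 K3) (u : kmap K1 K2) n :
  rmap r1 r3 (kcomp v u) n = rmap r2 r3 v n ∘ rmap r1 r2 u n.
Proof.
apply: (@rinc_mono _ _ _ r3).
by rewrite rinc_rmap [RHS]compA rinc_rmap -[RHS]compA rinc_rmap [RHS]compA -lin_evalM.
Qed.

(** The same [u] serves [F] and [G], so [lin_eval_nat] makes the square commute already on chains;
    naturality in the functor rests on this. *)
Lemma rmap_nat F G (t : nattrans F G) K L M M' N N' (r : realization F K M)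
    (r' : realization G K M') (s : realization F L N) (s' : realization G L N')
    (f : chain_map M M') (g : chain_map N N') (u : kmap K L) n :
  rinc r' n ∘ f n = t (K n.+1) ∘ rinc r n ->
  rinc s' n ∘ g n = t (L n.+1) ∘ rinc s n ->
  rmap r' s' u n ∘ f n = g n ∘ rmap r s u n.
Proof.
move=> fE gE; apply: (@rinc_mono _ _ _ s').
rewrite [LHS]compA rinc_rmap -[LHS]compA fE [LHS]compA -lin_eval_nat.
by rewrite [RHS]compA gE -[RHS]compA rinc_rmap [RHS]compA.
Qed.

End RealizationFunctor.

(** * The complex of a simplicial resolution *)

Section SimplicialSide.
Variables (C : category) (P : C -> Prop).

Section Object.
Variables (c : C) (S : ps_resolution P c).

Definition aug_diff n : hom (aug_obj S n.+1 : lin C) (aug_obj S n : lin C) :=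
  \sum_(i < n.+1) lin_gen (aug_face S n i) *~ (-1) ^+ i.

Lemma aug_diff_sq n : aug_diff n ∘ aug_diff n.+1 = 0.
Proof.
apply: (@alt_sum_sq (lin C) _ _ _ (fun i => lin_gen (aug_face S n i))
  (fun i => lin_gen (aug_face S n.+1 i))) => i j lij.
by rewrite -!lin_genM aug_faceE.
Qed.

Definition ps_kcomplex : kcomplex (lin C).
Proof.
exists (ChainComplex aug_diff_sq) (fun n => idm (aug_obj S n : lin C)) => n.
- exact: comp1m.
- exact: compm1.
- exact: comp1m.
Defined.

(* An extra degeneracy, obtained by filling: s x is a simplex with faces
   x, s (d_0 x), ..., s (d_n x). *)
Lemma aug_contraction q : P q ->
  exists s : forall n, hom q (aug_obj S n) -> hom q (aug_obj S n.+1),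
    (forall n x, aug_face S n 0 ∘ s n x = x) /\
    (forall n i x, (i <= n)%N -> aug_face S n.+1 i.+1 ∘ s n.+1 x = s n (aug_face S n i ∘ x)).
Proof.
move=> Pq.
pose T n := hom q (aug_obj S n) -> hom q (aug_obj S n.+1).
pose R n (s : T n) (s' : T n.+1) := [/\ forall x, aug_face S n 0 ∘ s x = x,
  forall x, aug_face S n.+1 0 ∘ s' x = x &
  forall i x, (i <= n)%N -> aug_face S n.+1 i.+1 ∘ s' x = s (aug_face S n i ∘ x)].
have fill n (s : T n) : (forall x, aug_face S n 0 ∘ s x = x) ->
    (forall i j x, (i < j <= n)%N ->
      aug_face S n i.+1 ∘ s (aug_face S n j ∘ x) =
      aug_face S n j ∘ s (aug_face S n i ∘ x)) -> exists s', R n s s'.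
  move=> s0 sE.
  (* One filler is chosen for each [x] separately; [s'] is a mere function on the Hom set. *)
  have /choice[s' s'E] : forall x, exists y, forall i, (i <= n.+1)%N ->
      aug_face S n.+1 i ∘ y = if i is k.+1 then s (aug_face S n k ∘ x) else x.
    move=> x; apply: aug_exactS => // i [|j]; first by rewrite ltn0.
    case: i => [|i] lij; first by rewrite s0.
    exact: sE.
  by exists s'; split => // [x|i x li]; rewrite s'E.
have /choice[s0 s0E] : forall x : hom q (aug_obj S 0), exists y, aug_face S 0 0 ∘ y = x.
  by move=> x; apply: aug_exact0.
have [s1 R0] : exists s1, R 0%N s0 s1 by apply: fill => // i j x; lia.
have step n s s' : R n s s' -> exists s'', R n.+1 s' s''.
  move=> [_ s'0 sE]; apply: fill => // i [|j] x lij; first lia.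
  by rewrite !sE ?compA; try lia; rewrite aug_faceE //; lia.
have [s [_ sR]] := dependent_tower step R0.
by exists s; split=> n; have [] := sR n.
Qed.

(** The extra degeneracy gives d s = 1 in degree 0 and d s + s d = 1 above, the faces from 1 on
    contributing - s d; hence a cycle [x] is the boundary of s x. *)
Lemma ps_kexact : kexact (A := lin C) P ps_kcomplex.
Proof.
move=> q Pq n x _ dx; have [s [s0 sS]] := aug_contraction Pq.
exists (lin_ext (s n) x); first exact: comp1m.
case: n x dx => [|n] x dx.
  by rewrite [LHS]/(aug_diff 0 ∘ _) /aug_diff big_ord1 mulr1z; apply: lin_comp_ext; apply: s0.
have E (y : hom (q : lin C) (aug_obj S n.+1 : lin C)) :
    aug_diff n.+1 ∘ lin_ext (s n.+1) y = y - lin_ext (s n) (aug_diff n ∘ y).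
  rewrite {1}/aug_diff big_ord_recl compDl expr0 mulr1z lin_comp_ext; last exact: s0.
  congr (_ + _); rewrite !comp_suml lin_ext_sum -sumrN; apply: eq_bigr => i _.
  rewrite !compsl (@lin_ext_comp _ _ _ _ _ _ _ _ _ (s n) (aug_face S n i)) => [|z].
    by rewrite lin_extMz !signz /=; case: odd; rewrite ?opprK.
  by rewrite sS // -ltnS.
have dx0 : aug_diff n ∘ x = 0 by exact: dx.
by rewrite [LHS]E dx0 lin_ext0 subr0.
Qed.

Definition ps_realization (B : abelian) (F : functor C B) :
  realization F ps_kcomplex (ps_complex (ps_image F S)).
Proof.
exists (fun n => idm (F (S n))) (fun n => idm (F (S n))) => n.
- by rewrite comp1m.
- by rewrite comp1m lin_eval1.
rewrite comp1m compm1 /= /aug_diff lin_eval_sum; apply: eq_bigr => i _.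
by rewrite lin_evalMz lin_eval_gen.
Defined.

End Object.

Section Map.
Variables (c d : C) (f : hom c d) (S : ps_resolution P c) (T : ps_resolution P d).
Variables (u : ps_map S T) (uf : ps_lifts f u).

Definition aug_map n : hom (aug_obj S n) (aug_obj T n) :=
  match n with 0 => f | m.+1 => u m end.

Lemma aug_map_diff n :
  lin_gen (aug_map n) ∘ aug_diff S n = aug_diff T n ∘ lin_gen (aug_map n.+1).
Proof.
rewrite comp_sumr comp_suml; apply: eq_bigr => i _.
rewrite compsr compsl -!lin_genM; congr (lin_gen _ *~ _).
have := ltn_ord i; case: n i => [|n] i li /=; first by rewrite uf.
by rewrite psmapE.
Qed.

Definition ps_kmap : kmap (ps_kcomplex S) (ps_kcomplex T).
Proof.
exists (@ChainMap _ (ps_kcomplex S) (ps_kcomplex T) _ aug_map_diff) => n.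
exact: comp1m.
Defined.

Lemma rmap_ps (B : abelian) (F : functor C B) n :
  rmap (ps_realization S F) (ps_realization T F) ps_kmap n = fmap F (u n).
Proof. by rewrite /= /rmap_comp /= comp1m compm1 lin_eval_gen. Qed.

End Map.
End SimplicialSide.

(** * The complex of a cubical resolution *)

Section CubeIdempotent.
Variables (A : preadditive) (Y : pseudocubical A).

(** [is_normal] presupposes an abelian category; this version makes sense in [lin C]. *)
Definition cube_normal n a : hom a (Y n) -> Prop :=
  match n return hom a (Y n) -> Prop with
  | 0 => fun=> True
  | m.+1 => fun x => forall i, (0 < i <= m.+1)%N -> pcface Y m true i ∘ x = 0
  end.

Lemma cube_normal_comp n a b (x : hom a (Y n)) (y : hom b a) :
  cube_normal x -> cube_normal (x ∘ y).
Proof. by case: n x => [|n] x //= xN i lin; rewrite compA xN ?comp0m. Qed.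

Fixpoint cube_proj_upto n k : hom (Y n.+1) (Y n.+1) :=
  if k is j.+1
  then cube_proj_upto n j ∘ (idm (Y n.+1) - pcdegen Y n j.+1 ∘ pcface Y n true j.+1)
  else idm (Y n.+1).

(** For i > j the face d_i passes 1 - s_j d_j by the face and degeneracy relations; [z] is the
    product of the same factors one dimension lower. *)
Lemma face_cube_proj_upto_gt n k i : (k < i <= n.+1)%N ->
  exists z, pcface Y n true i ∘ cube_proj_upto n k = z ∘ pcface Y n true i.
Proof.
elim: k => [|k IH] lki; first by exists (idm _); rewrite compm1 comp1m.
have [|z zE] := IH; first lia.
case: n lki {IH} z zE => [|n] lki z zE; first lia.
exists (z ∘ (idm (Y n.+1) - pcdegen Y n k.+1 ∘ pcface Y n true k.+1)).
rewrite /= compA zE -!compA; congr (_ ∘ _).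
rewrite compBr compBl compm1 comp1m; congr (_ - _).
rewrite compA pcface_degen_gt; last lia.
by rewrite -!compA [in RHS]pcface_face //; lia.
Qed.

(** d_k passes the factors of smaller index and then kills 1 - s_k d_k, since d_k s_k = 1; for i < k
    the shorter product is already killed. *)
Lemma face_cube_proj_upto n k i : (0 < i <= k)%N -> (k <= n.+1)%N ->
  pcface Y n true i ∘ cube_proj_upto n k = 0.
Proof.
elim: k => [|k IH] lik lkn /=; first lia.
rewrite compA; have [->|ik] := eqVneq i k.+1; last first.
  by rewrite IH ?comp0m //; lia.
have [|z ->] := @face_cube_proj_upto_gt n k k.+1; first lia.
rewrite -compA compBr compm1 compA pcface_degen_eq; last lia.
by rewrite comp1m subrr compm0.
Qed.

Lemma cube_proj_upto_id n k a (x : hom a (Y n.+1)) : (k <= n.+1)%N ->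
  cube_normal x -> cube_proj_upto n k ∘ x = x.
Proof.
move=> + xN; elim: k => [|k IH] lkn /=; first exact: comp1m.
rewrite -compA compBl comp1m -compA xN; last lia.
by rewrite compm0 subr0 IH //; lia.
Qed.

(** A projection onto the normal elements: its values are normal and it fixes normal elements, hence
    it is idempotent. *)
Definition cube_proj n : hom (Y n) (Y n) :=
  match n with 0 => idm (Y 0) | m.+1 => cube_proj_upto m m.+1 end.

Lemma cube_proj_normal n : cube_normal (cube_proj n).
Proof. by case: n => [|n] // i lin; apply: face_cube_proj_upto. Qed.

Lemma cube_proj_id n a (x : hom a (Y n)) : cube_normal x -> cube_proj n ∘ x = x.
Proof.
case: n x => [|n] x xN; first exact: comp1m.
exact: cube_proj_upto_id.
Qed.

Definition cube_sum n : hom (Y n.+1) (Y n) :=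
  \sum_(i < n.+1) pcface Y n false i.+1 *~ (-1) ^+ i.

Lemma cube_sum_sq n : cube_sum n ∘ cube_sum n.+1 = 0.
Proof.
apply: (alt_sum_sq (d := fun i => pcface Y n false i.+1)
                   (e := fun i => pcface Y n.+1 false i.+1)) => i j lij.
by rewrite pcface_face /=; [case: j lij|lia].
Qed.

Lemma cube_sum_normal n a (x : hom a (Y n.+1)) :
  cube_normal x -> cube_normal (cube_sum n ∘ x).
Proof.
case: n x => [//|n] x xN i lin.
rewrite compA comp_sumr comp_suml big1 // => j _.
have lj := ltn_ord j.
rewrite compsr compsl signz.
suff -> : pcface Y n true i ∘ pcface Y n.+1 false j.+1 ∘ x = 0.
  by rewrite oppr0 if_same.
have [ij|ji] := leqP i j.
  by rewrite pcface_face -?compA ?xN ?compm0 //; lia.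
(* The face relation is read backwards here, with [i.+1] as the larger index. *)
rewrite -[i]/(i.+1.-1) -pcface_face; last lia.
by rewrite -compA xN ?compm0 //; lia.
Qed.

End CubeIdempotent.

(** * Exactness and realization of the normalized cubical complex *)

Section CubicalSide.
Variables (C : category) (P : C -> Prop).

Lemma lin_eval_cube_proj (B : preadditive) (F : functor C B) (X : pseudocubical C) n :
  lin_eval F (cube_proj (pc_image (lin_incl C) X) n) = cube_proj (pc_image F X) n.
Proof.
case: n => [|n]; first exact: lin_eval1.
suff E k : lin_eval F (cube_proj_upto (pc_image (lin_incl C) X) n k) =
    cube_proj_upto (pc_image F X) n k by exact: E.
elim: k => [|k IH]; first exact: lin_eval1.
rewrite /= lin_evalM IH lin_evalB lin_eval1 lin_evalM; congr (_ ∘ (_ - _ ∘ _)).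
  exact: lin_eval_gen.
exact: lin_eval_gen.
Qed.

Section Object.
Variables (c : C) (X : pc_resolution P c).

Let Y : pseudocubical (lin C) := pc_image (lin_incl C) X.

Definition cub_obj n : lin C := if n is m.+1 then X m else c.
Definition cub_idem n : hom (cub_obj n) (cub_obj n) :=
  match n with 0 => idm (c : lin C) | m.+1 => cube_proj Y m end.
(** Precomposition with [cube_proj] makes the differential absorb its source idempotent. *)
Definition cub_diff n : hom (cub_obj n.+1) (cub_obj n) :=
  match n with 0 => lin_gen (pcr_aug X) | m.+1 => cube_sum Y m ∘ cube_proj Y m.+1 end.

Lemma cub_idem_idem n : cub_idem n ∘ cub_idem n = cub_idem n.
Proof.
case: n => [|n]; first exact: comp1m.
by apply: (@cube_proj_id _ Y n); apply: cube_proj_normal.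
Qed.

Lemma cub_idem_diff n : cub_idem n ∘ cub_diff n = cub_diff n.
Proof.
case: n => [|n]; first exact: comp1m.
by apply: (@cube_proj_id _ Y n); apply: cube_sum_normal; apply: cube_proj_normal.
Qed.

Lemma cub_diff_idem n : cub_diff n ∘ cub_idem n.+1 = cub_diff n.
Proof.
case: n => [|n]; first exact: compm1.
by rewrite -[LHS]compA; congr (_ ∘ _); apply: cub_idem_idem.
Qed.

Lemma cub_diff_sq n : cub_diff n ∘ cub_diff n.+1 = 0.
Proof.
case: n => [|n].
  (* After the augmentation the two faces agree, and the face of type 1 kills normal elements. *)
  have E : lin_gen (pcr_aug X) ∘ pcface Y 0 false 1 = lin_gen (pcr_aug X) ∘ pcface Y 0 true 1.
    by rewrite -[LHS]lin_genM -[RHS]lin_genM pcr_augE.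
  rewrite [LHS]compA /cube_sum big_ord1 expr0 mulr1z E -compA.
  by rewrite (@cube_proj_normal _ Y 1) ?compm0.
rewrite -[LHS]compA (@cub_idem_diff n.+2) [LHS]compA.
by rewrite (cube_sum_sq Y n) comp0m.
Qed.

Definition pc_kcomplex : kcomplex (lin C) :=
  @KComplex _ (ChainComplex cub_diff_sq) cub_idem cub_idem_idem cub_diff_idem
    cub_idem_diff.

Fixpoint cub_aug n : hom (X n) c :=
  match n with 0 => pcr_aug X | m.+1 => cub_aug m ∘ pcface X m true 1 end.

(** [cub_aug] is built from faces of type 1 in direction 1; any other face is exchanged into the
    next lower dimension, where induction replaces it. *)
Lemma cub_augE n e i : (0 < i <= n.+1)%N ->
  cub_aug n ∘ pcface X n e i = cub_aug n.+1.
Proof.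
elim: n e i => [|n IH] e i lin.
  have -> : i = 1%N by lia.
  by case: e; rewrite //= pcr_augE.
have sw a b : pcface X n a 1 ∘ pcface X n.+1 b 2 = pcface X n b 1 ∘ pcface X n.+1 a 1.
  exact: pcface_face.
case: i lin => [//|[|i]] lin /=.
  case: e => //; rewrite -!compA -[in LHS]sw [LHS]compA IH //.
  by rewrite /= -compA sw.
rewrite -!compA (@pcface_face _ X n true e 1 i.+2); last lia.
by rewrite compA IH; [rewrite /= compA|lia].
Qed.

(* h x is a cube with faces x and a constant cube in the first direction, and
   with the cubes h (d_i x) as the other faces; k y is a constant cube. *)
Lemma cub_contraction q : P q ->
  exists (k : forall n, hom q c -> hom q (X n)) (h : forall n, hom q (X n) -> hom q (X n.+1)),
  [/\ forall y, pcr_aug X ∘ k 0%N y = y,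
      forall n x, pcface X n false 1 ∘ h n x = x,
      forall n x, pcface X n true 1 ∘ h n x = k n (cub_aug n ∘ x) &
      forall n e i x, (0 < i <= n.+1)%N ->
        pcface X n.+1 e i.+1 ∘ h n.+1 x = h n (pcface X n e i ∘ x)].
Proof.
move=> Pq; have [exc ex0 exn] := pcr_exact X Pq.
have [k [k0 kS]] : exists k : forall n, hom q c -> hom q (X n),
    (forall y, pcr_aug X ∘ k 0%N y = y) /\
    (forall n e i y, (0 < i <= n.+1)%N -> pcface X n e i ∘ k n.+1 y = k n y).
  pose R n (k : hom q c -> hom q (X n)) (k' : hom q c -> hom q (X n.+1)) :=
    forall e i y, (0 < i <= n.+1)%N -> pcface X n e i ∘ k' y = k y.
  have /choice[k0 k0E] : forall y : hom q c, exists x, pcr_aug X ∘ x = y by exact: exc.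
  have [k1 R0] : exists k1, R 0%N k0 k1.
    have /choice[k1 k1E] : forall y, exists z,
        pcface X 0 false 1 ∘ z = k0 y /\ pcface X 0 true 1 ∘ z = k0 y.
      by move=> y; apply: ex0.
    exists k1 => e i y li; have -> : i = 1%N by lia.
    by case: e; have [] := k1E y.
  have step n u v : R n u v -> exists w, R n.+1 v w.
    move=> uv; have /choice[w wE] : forall y, exists z,
        forall e i, (0 < i <= n.+2)%N -> pcface X n.+1 e i ∘ z = v y.
      by move=> y; apply: (exn n (fun _ _ => v y)) => a e i j lij; rewrite !uv //; lia.
    by exists w => e i y li; apply: wE.
  have [k [kk0 kR]] := dependent_tower step R0.
  by exists k; split=> [y|n]; [rewrite kk0|apply: kR].
exists k.
pose T n := hom q (X n) -> hom q (X n.+1).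
pose Q n (h : T n) := (forall x, pcface X n false 1 ∘ h x = x) /\
  (forall x, pcface X n true 1 ∘ h x = k n (cub_aug n ∘ x)).
pose R n (h : T n) (h' : T n.+1) := [/\ Q n h, Q n.+1 h' &
  forall e i x, (0 < i <= n.+1)%N ->
    pcface X n.+1 e i.+1 ∘ h' x = h (pcface X n e i ∘ x)].
have fill n (h : T n) : Q n h ->
    (forall a e i j x, [&& 0 < i, i < j & j <= n.+1]%N ->
      pcface X n a i.+1 ∘ h (pcface X n e j ∘ x) =
      pcface X n e j ∘ h (pcface X n a i ∘ x)) -> exists h', R n h h'.
  move=> [hf ht] hh.
  (* Directions from 2 on carry [h] of the faces of [x]; direction 1 carries [x] and the constant
     cube. *)
  have /choice[h' h'E] : forall x, exists y, forall e i, (0 < i <= n.+2)%N ->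
      pcface X n.+1 e i ∘ y = if i is j.+2 then h (pcface X n e j.+1 ∘ x)
                              else if e then k n.+1 (cub_aug n.+1 ∘ x) else x.
    move=> x; apply: (exn n (fun e i => if i is j.+2 then h (pcface X n e j.+1 ∘ x)
                              else if e then k n.+1 (cub_aug n.+1 ∘ x) else x)).
    move=> a e [|[|i]] [|[|j]] lij; try lia.
      (* On the side of type 1 both terms are constant cubes, over the same element by
         [cub_augE]. *)
      case: a; rewrite ?hf // ht kS; last lia.
      by rewrite compA cub_augE //; lia.
    exact: hh.
  exists h'; split => //; first by split=> x; rewrite h'E.
  by move=> e [|i] x li; rewrite ?h'E //; lia.
have [h0 Q0] : exists h0, Q 0%N h0.
  have /choice[h0 h0E] : forall x, exists z,
      pcface X 0 false 1 ∘ z = x /\ pcface X 0 true 1 ∘ z = k 0%N (pcr_aug X ∘ x).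
    by move=> x; apply: ex0; rewrite k0.
  by exists h0; split=> x; have [] := h0E x.
have [h1 R0] : exists h1, R 0%N h0 h1 by apply: fill => // a e i j x; lia.
have step n h h' : R n h h' -> exists h'', R n.+1 h' h''.
  move=> [_ Qh' hE]; apply: fill => // a e i [|j] x lij; first lia.
  rewrite !hE; try lia.
  by rewrite !compA pcface_face //; lia.
have [h [_ hR]] := dependent_tower step R0.
by exists h; split=> // n; have [[? ?] ? ?] := hR n.
Qed.

(** At the augmentation [k] lifts [x]. Above, for a normal cycle [x] the cube h x is normal, its
    first face of type 0 is [x], and its other faces of type 0 sum to - h (d x) = 0. *)
Lemma pc_kexact : kexact (A := lin C) P pc_kcomplex.
Proof.
move=> q Pq n x xN dx.
have [k [h [k0 hf ht hS]]] := cub_contraction Pq.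
case: n x xN dx => [|n] x xN dx.
  exists (lin_ext (k 0%N) x); first exact: comp1m.
  exact: lin_comp_ext.
have {}xN : cube_normal (Y := Y) (n := n) x.
  by rewrite -xN; apply: cube_normal_comp; apply: cube_proj_normal.
have hS' m e i (z : hom (q : lin C) (X m.+1 : lin C)) : (0 < i <= m.+1)%N ->
    pcface Y m.+1 e i.+1 ∘ lin_ext (h m.+1) z = lin_ext (h m) (pcface Y m e i ∘ z).
  by move=> li; apply: lin_ext_comp => y; apply: hS.
have hN : cube_normal (Y := Y) (n := n.+1) (lin_ext (h n) x).
  move=> [|[|i]] // li.
    rewrite [LHS](@lin_ext_comp _ _ _ _ _ _ _ _ _ (k n) (cub_aug n)); last exact: ht.
    (* In cubical degree 0 this is the cycle condition; above, [cub_aug] factors through a face of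
       type 1, which kills the normal [x]. *)
    suff -> : lin_gen (cub_aug n) ∘ x = 0 by exact: lin_ext0.
    case: n x xN dx {li} => [|n] x xN dx; first exact: dx.
    rewrite [lin_gen _](lin_genM (cub_aug n) (pcface X n true 1)) -[LHS]compA.
    suff -> : lin_gen (pcface X n true 1) ∘ x = 0 by exact: (@compm0 (lin C)).
    exact: (xN 1%N).
  case: n x xN dx li => [|n] x xN dx li; first by lia.
  rewrite [LHS]hS'; last by lia.
  by rewrite xN ?lin_ext0 //; lia.
exists (lin_ext (h n) x); first exact: (@cube_proj_id _ Y n.+1).
have -> : diff pc_kcomplex n.+1 ∘ lin_ext (h n) x = cube_sum Y n ∘ lin_ext (h n) x.
  by rewrite -[LHS](@compA (lin C)) (@cube_proj_id _ Y n.+1).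
rewrite /cube_sum big_ord_recl compDl expr0 mulr1z.
have -> : pcface Y n false 1 ∘ lin_ext (h n) x = x by apply: lin_comp_ext; apply: hf.
rewrite -[RHS]addr0; congr (_ + _); rewrite comp_suml.
case: n x xN dx {hN} => [|n] x xN dx; first by rewrite big_ord0.
have dx0 : cube_sum Y n ∘ x = 0.
  by rewrite -[x in LHS](@cube_proj_id _ Y n.+1 _ x xN) compA; apply: dx.
transitivity (- lin_ext (h n) (cube_sum Y n ∘ x)); last by rewrite dx0 lin_ext0 oppr0.
rewrite /cube_sum comp_suml lin_ext_sum -sumrN; apply: eq_bigr => i _.
rewrite !compsl [X in X *~ _]hS'; last by have := ltn_ord i; rewrite /= /bump; lia.
by rewrite lin_extMz !signz /=; case: odd; rewrite ?opprK.
Qed.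

Section Realization.
Variables (B : abelian) (F : functor C B).

Lemma lin_eval_cube_proj_normal n :
  is_normal (X := pc_image F X) (lin_eval F (cube_proj Y n)).
Proof.
rewrite lin_eval_cube_proj; have := @cube_proj_normal _ (pc_image F X) n.
by case: n.
Qed.

Lemma lin_eval_cube_proj_inc n :
  lin_eval F (cube_proj Y n) ∘ normal_inc (pc_image F X) n = normal_inc (pc_image F X) n.
Proof.
rewrite lin_eval_cube_proj; apply: (@cube_proj_id _ (pc_image F X) n).
by have := @normal_inc_normal _ (pc_image F X) n; case: n.
Qed.

Lemma lin_eval_cube_sum n : lin_eval F (cube_sum Y n) = pc_sum (pc_image F X) n.
Proof.
rewrite pc_sumE lin_eval_sum; apply: eq_bigr => i _.
by rewrite lin_evalMz lin_eval_gen.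
Qed.

(** [F] sends [cube_proj] to an idempotent whose image is the normalized subobject; the retraction
    is its corestriction. *)
Definition pc_realization :
  realization F pc_kcomplex (normal_complex (pc_image F X)).
Proof.
exists (@normal_inc _ (pc_image F X))
  (fun n => normal_lift (lin_eval_cube_proj_normal n)) => n.
- apply: normal_inc_mono.
  by rewrite compA normal_liftE lin_eval_cube_proj_inc compm1.
- exact: (normal_liftE (lin_eval_cube_proj_normal n)).
rewrite [LHS]normal_diffE [in RHS]lin_evalM lin_eval_cube_sum -[RHS]compA.
by rewrite lin_eval_cube_proj_inc.
Defined.

End Realization.
End Object.

Section Map.
Variables (c d : C) (f : hom c d) (X : pc_resolution P c) (X' : pc_resolution P d).
Variables (u : precubical_map X X') (uf : pc_lifts f u).

Let Y : pseudocubical (lin C) := pc_image (lin_incl C) X.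
Let Y' : pseudocubical (lin C) := pc_image (lin_incl C) X'.
Let v : precubical_map Y Y' := pc_image_map (lin_incl C) u.

(* The cubical map itself need not commute with the idempotents, because it need
   not commute with the pseudodegeneracies. *)
Definition cub_map n : hom (cub_obj X n) (cub_obj X' n) :=
  match n with 0 => lin_gen f | m.+1 => v m ∘ cube_proj Y m end.

Lemma cub_mapN n : cub_idem X' n ∘ cub_map n = cub_map n.
Proof.
case: n => [|n]; first exact: comp1m.
apply: (@cube_proj_id _ Y' n); case: n => [//|n] i li.
rewrite compA -pcmapE // -compA (@cube_proj_normal _ Y n.+1) //.
exact: compm0.
Qed.

Lemma cub_map_diff n : cub_map n ∘ cub_diff X n = cub_diff X' n ∘ cub_map n.+1.
Proof.
case: n => [|n].
  rewrite [cub_map 1]compm1 -[LHS]lin_genM -[RHS]lin_genM.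
  by congr lin_gen; rewrite uf.
(* The inner projections are absorbed by maps with normal values; what remains is that [v] commutes
   with the faces of type 0. *)
rewrite -[LHS]compA [X in _ ∘ X](cub_idem_diff X n.+1).
rewrite -[RHS]compA [X in _ = _ ∘ X](cub_mapN n.+2) [LHS]compA [RHS]compA.
congr (_ ∘ _); rewrite comp_sumr comp_suml; apply: eq_bigr => i _.
by rewrite compsr compsl (pcmapE v) //; apply: ltn_ord.
Qed.

Definition pc_kmap : kmap (pc_kcomplex X) (pc_kcomplex X') :=
  @KMap _ (pc_kcomplex X) (pc_kcomplex X')
    (@ChainMap _ (pc_kcomplex X) (pc_kcomplex X') _ cub_map_diff) cub_mapN.

Lemma rmap_pc (B : abelian) (F : functor C B) n :
  rmap (pc_realization X F) (pc_realization X' F) pc_kmap n =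
  normal_map (pc_image_map F u) n.
Proof.
apply: normal_inc_mono; rewrite normal_mapE.
rewrite [LHS](rinc_rmap (pc_realization X F) (pc_realization X' F)).
by rewrite [in LHS]lin_evalM -[LHS]compA lin_eval_cube_proj_inc lin_eval_gen.
Qed.

End Map.
End CubicalSide.

(** * The comparison isomorphism and its naturality *)

Theorem theorem1p1 (C : category) (C_lim : has_finite_limits C)
    (P : C -> Prop) (P_proj : projective_class P)
    (S : forall c : C, ps_resolution P c)
    (X : forall c : C, pc_resolution P c)
    (B : abelian) (n : nat) :
  exists phi : forall F : functor C B,
      nattrans (simplicial_derived S n F) (cubical_derived X n F),
    (forall (F : functor C B) (c : C), is_iso (phi F c)) /\
    (forall (F G : functor C B) (t : nattrans F G) (c : C),
       (phi G c ∘ simplicial_derived_nat S n t c =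
        cubical_derived_nat X n t c ∘ phi F c)%cat).
Proof.
pose KS c := ps_kcomplex (S c); pose KX c := pc_kcomplex (X c).
have PS c m : P (KS c m.+1) by apply: psr_proj.
have PX c m : P (KX c m.+1) by apply: pcr_proj.
have XS c : kexact (A := lin C) P (KS c) by apply: ps_kexact.
have XX c : kexact (A := lin C) P (KX c) by apply: pc_kexact.
(* The comparison maps in both directions lie over the identity of [c] and are fixed independently
   of [F]. *)
have exa c : exists u : kmap (KS c) (KX c), u 0%N = idm (c : lin C).
  by apply: kmap_exists (PS c) (XX c) _ _; apply: compm1.
have exb c : exists u : kmap (KX c) (KS c), u 0%N = idm (c : lin C).
  by apply: kmap_exists (PX c) (XS c) _ _; apply: compm1.
have [a aE] : {a : forall c, kmap (KS c) (KX c) & forall c, a c 0%N = idm (c : lin C)}.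
  by exists (fun c => sval (cid (exa c))) => c; case: cid.
have [b bE] : {b : forall c, kmap (KX c) (KS c) & forall c, b c 0%N = idm (c : lin C)}.
  by exists (fun c => sval (cid (exb c))) => c; case: cid.
pose rS F c := ps_realization (S c) F; pose rX F c := pc_realization (X c) F.
pose phi F c : hom (simplicial_derived S n F c) (cubical_derived X n F c) :=
  homology_map (rmap (rS B F c) (rX B F c) (a c)) n.
pose psi F c : hom (cubical_derived X n F c) (simplicial_derived S n F c) :=
  homology_map (rmap (rX B F c) (rS B F c) (b c)) n.
have phiN F c d (f : hom c d) :
    phi F d ∘ fmap (simplicial_derived S n F) f = fmap (cubical_derived X n F) f ∘ phi F c.
  pose uS := ps_kmap (ps_liftP S f); pose uX := pc_kmap (pc_liftP X f).
  rewrite /phi -(@homology_map_comp _ _ _ _ _ _ (rmap (rS B F c) (rX B F d) (kcomp (a d) uS))).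
    rewrite -(@homology_map_comp _ _ _ _ _ _ (rmap (rS B F c) (rX B F d) (kcomp uX (a c)))).
      (* Naturality in [c]: both composites from [KS c] to [KX d] restrict to [f] in degree 0, hence
         are homotopic. *)
      apply: (rmap_htpy _ _ _ (PS c) (XX d)).
      rewrite -[LHS]/(a d 0%N ∘ lin_gen f) -[RHS]/(lin_gen f ∘ a c 0%N) !aE.
      by rewrite compm1 comp1m.
    by rewrite (rmap_kcomp _ (rX B F c)) rmap_pc.
  by rewrite (rmap_kcomp _ (rS B F d)) rmap_ps.
exists (fun F => NatTrans (@phiN F)); split=> [F c|F G t c] /=.
  exists (psi F c); split.
    rewrite -(@homology_map_comp _ _ _ _ _ _ (rmap (rS B F c) (rS B F c) (kcomp (b c) (a c)))).
      (* The round trip and [kid] are both the identity of [c] in degree 0, hence are homotopic. *)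
      rewrite (rmap_htpy _ _ _ (PS c) (XS c) (v := kid _)).
        by apply: homology_map_id; apply: rmap_id.
      by rewrite -[LHS]/(b c 0%N ∘ a c 0%N) aE bE comp1m.
    exact: rmap_kcomp.
  rewrite -(@homology_map_comp _ _ _ _ _ _ (rmap (rX B F c) (rX B F c) (kcomp (a c) (b c)))).
    rewrite (rmap_htpy _ _ _ (PX c) (XX c) (v := kid _)).
      by apply: homology_map_id; apply: rmap_id.
    by rewrite -[LHS]/(a c 0%N ∘ b c 0%N) aE bE comp1m.
  exact: rmap_kcomp.
(* Naturality in [F] holds on chains: both composites agree with [w] in degree [n]. *)
pose w := chain_comp (rmap (rS B G c) (rX B G c) (a c))
  (ps_complex_map (ps_image_nat t (S c))).
rewrite -(@homology_map_comp _ _ _ _ _ _ w) //.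
apply: homology_map_comp; apply: (rmap_nat (t := t)).
  by rewrite /= comp1m compm1.
exact: (normal_mapE (pc_image_nat t (X c))).
Qed.
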